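(* Let $\varphi$ be an Orlicz $N$-function, let $w=(w(i))$ be a weight sequence, and let $F$ be a bounded linear functional on $\lambda_{\varphi,w}$ (with the Luxemburg norm). Then $F=H+S$, where $H(x)=\sum_{i=1}^\infty x(i)y(i)$ for all $x\in\lambda_{\varphi,w}$, for some $y\in\mathfrak m^0_{\varphi_*,w}$, with $\|H\|=\|y\|_{\mathfrak m^0_{\varphi_*,w}}$; $S$ is a singular functional, i.e. a bounded linear functional on $\lambda_{\varphi,w}$ vanishing on $(\lambda_{\varphi,w})_a$; and $$\|F\|_{(\lambda_{\varphi,w})^*}=\|y\|_{\mathfrak m^0_{\varphi_*,w}}+\|S\|,$$ where $\|H\|$ and $\|S\|$ are norms in $(\lambda_{\varphi,w})^*$.
   Context: An Orlicz function is a convex function $\varphi:[0,\infty)\to[0,\infty)$ with $\varphi(0)=0$ and $\varphi(t)>0$ for $t>0$. It is an $N$-function if $\lim_{t\to0}\varphi(t)/t=0$ and $\lim_{t\to\infty}\varphi(t)/t=\infty$. The complementary function is $\varphi_*(v)=\sup\{uv-\varphi(u):u\ge0\}$, $v\ge0$; it is an $N$-function when $\varphi$ is. For a real sequence $x=(x(i))$, $d_x(\lambda)=|\{i\in\mathbb N:|x(i)|>\lambda\}|$ for $\lambda>0$, and its decreasing rearrangement is $x^*(i)=\inf\{\lambda>0:d_x(\lambda)<i\}$. A weight sequence $w=(w(i))$ is positive and decreasing (non-increasing) with $\sum_{i=1}^\infty w(i)=\infty$. Put $\alpha_{\varphi,w}(x)=\sum_{i=1}^\infty\varphi(x^*(i))w(i)$.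 The Orlicz-Lorentz sequence space $\lambda_{\varphi,w}$ is the set of real sequences $x$ with $\alpha_{\varphi,w}(\eta x)<\infty$ for some $\eta>0$, equipped with the Luxemburg norm $\|x\|=\inf\{\epsilon>0:\alpha_{\varphi,w}(x/\epsilon)\le1\}$. The order-continuous subspace $(\lambda_{\varphi,w})_a$ consists of all $x\in\lambda_{\varphi,w}$ such that $\|x_n\|\downarrow0$ whenever $0\le x_n\le|x|$ and $x_n\downarrow0$ pointwise; it equals $\{x:\alpha_{\varphi,w}(\eta x)<\infty\ \text{for all}\ \eta>0\}$. For an Orlicz function $\psi$ and a real sequence $h$ put $p_{\psi,w}(h)=\inf\{\sum_{i=1}^\infty\psi(|h(i)|/v(i))\,v(i):\ v\prec w\}$, where $v$ ranges over non-negative sequences and $v\prec w$ means $\sum_{i=1}^nv^*(i)\le\sum_{i=1}^nw(i)$ for all $n\in\mathbb N$; where $v(i)=0$ the summand is $0$ if $h(i)=0$ and $\infty$ if $h(i)\ne0$. $\mathfrak m^0_{\psi,w}$ is the set of $h$ with $p_{\psi,w}(\eta h)<\infty$ for some $\eta>0$, equipped with the norm $\|h\|_{\mathfrak m^0_{\psi,w}}=\inf_{k>0}\frac1k(1+p_{\psi,w}(kh))$. *)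

(* Defs.v *)
From HB Require Import structures.
From mathcomp Require Import all_boot all_order all_algebra.
From mathcomp Require Import all_classical all_reals all_analysis.

Set Implicit Arguments.
Unset Strict Implicit.
Unset Printing Implicit Defensive.
Import Order.TTheory GRing.Theory Num.Theory.
Import numFieldNormedType.Exports.

Local Open Scope classical_set_scope.
Local Open Scope ring_scope.

(* Sequences are indexed from 0: the entry of index i here is the entry of
   index i + 1 of a sequence indexed from 1. *)

Section OrliczFunctions.
Variable R : realType.
Implicit Types phi : R -> R.

(* Functions on [0, +oo[ are functions on R whose values at negative reals are
   irrelevant. *)
Definition orlicz_function phi : Prop :=
  [/\ convex_function [set t : R^o | 0 <= t] phi,
      forall t : R, 0 <= t -> 0 <= phi t,
      phi 0 = 0 &
      forall t : R, 0 < t -> 0 < phi t].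

Definition N_function phi : Prop :=
  [/\ orlicz_function phi,
      phi t / t @[t --> 0^'+] --> 0 &
      phi t / t @[t --> +oo] --> +oo].

(* The real supremum is the genuine one when phi is an N-function and 0 <= v:
   the set is then nonempty and bounded above. *)
Definition complementary phi (v : R) : R :=
  sup [set u * v - phi u | u in [set u | 0 <= u]].

End OrliczFunctions.

Section OrliczLorentz.
Variable R : realType.
Local Open Scope ereal_scope.
Implicit Types (phi psi : R -> R) (w x y h v : nat -> R).

Definition distribution_fun x (l : R) : \bar R :=
  counting [set i : nat | (l < `|x i|)%R].

(* Extended real: the value is +oo everywhere when x is unbounded. The strict
   bound by i + 1 accounts for the indexing from 0. *)
Definition rearrangement x (i : nat) : \bar R :=
  ereal_inf [set l%:E | l in
    [set l : R | (0 < l)%R /\ distribution_fun x l < (i.+1)%:R%:E]].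

Definition weight w : Prop :=
  [/\ forall i, (0 < w i)%R,
      nonincreasing_seq w &
      \sum_(0 <= i <oo) (w i)%:E = +oo].

(* er_map extends phi by phi(+oo) = +oo. *)
Definition modular phi w x : \bar R :=
  \sum_(0 <= i <oo) er_map phi (rearrangement x i) * (w i)%:E.

Definition orlicz_lorentz phi w : set (nat -> R) :=
  [set x | exists2 eta : R, (0 < eta)%R &
    modular phi w (fun i => eta * x i)%R < +oo].

Definition luxemburg phi w x : \bar R :=
  ereal_inf [set e%:E | e in
    [set e : R | (0 < e)%R /\ modular phi w (fun i => x i / e)%R <= 1]].

Definition order_continuous_part phi w : set (nat -> R) :=
  [set x | orlicz_lorentz phi w x /\
    forall u : nat -> nat -> R,
      (forall n i, (0 <= u n i <= `|x i|)%R) ->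
      (forall i, nonincreasing_seq (fun n => u n i)) ->
      (forall i, u n i @[n --> \oo] --> 0%R) ->
      nonincreasing_seq (fun n => luxemburg phi w (u n)) /\
      luxemburg phi w (u n) @[n --> \oo] --> 0].

Definition submajorized v w : Prop :=
  forall n, \sum_(i < n) rearrangement v i <= \sum_(i < n) (w i)%:E.

Definition p_term psi (a b : R) : \bar R :=
  if b == 0%R then (if a == 0%R then 0 else +oo)
  else (psi (`|a| / b) * b)%R%:E.

Definition p_modular psi w h : \bar R :=
  ereal_inf [set \sum_(0 <= i <oo) p_term psi (h i) (v i) | v in
    [set v : nat -> R | (forall i, (0 <= v i)%R) /\ submajorized v w]].

Definition m0_space psi w : set (nat -> R) :=
  [set h | exists2 eta : R, (0 < eta)%R &
    p_modular psi w (fun i => eta * h i)%R < +oo].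

Definition m0_norm psi w h : \bar R :=
  ereal_inf [set (k^-1)%:E * (1 + p_modular psi w (fun i => k * h i)%R) | k in
    [set k : R | (0 < k)%R]].

(* A functional on the Orlicz-Lorentz space is a function on all sequences of
   which only the restriction to the space matters. *)
Definition bounded_functional phi w (F : (nat -> R) -> R) : Prop :=
  (forall (a : R) x y, orlicz_lorentz phi w x -> orlicz_lorentz phi w y ->
     F (fun i => a * x i + y i)%R = (a * F x + F y)%R) /\
  (exists C : R, forall x, orlicz_lorentz phi w x ->
     `|F x|%:E <= C%:E * luxemburg phi w x).

Definition dual_norm phi w (F : (nat -> R) -> R) : \bar R :=
  ereal_sup [set `|F x|%:E | x in
    [set x | orlicz_lorentz phi w x /\ luxemburg phi w x <= 1]].

Definition singular_functional phi w (S : (nat -> R) -> R) : Prop :=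
  bounded_functional phi w S /\
  forall x, order_continuous_part phi w x -> S x = 0%R.

End OrliczLorentz.

(* Main.v *)
(* The functional H keeps the values y_i of F at the unit sequences, and S = F - H
   vanishes on finitely supported sequences.  All modulars are computed as
   suprema, over finite lists of distinct indices, of weighted sums of
   phi(|x_i|); up to a factor arbitrarily close to 1 this avoids decreasing
   rearrangements.

   ||H|| <= ||y|| is Young's inequality.  For the converse, maximizing
   sum |y_i| x_i under the constraint that the modular be at most 1 is a convex
   problem; Hahn-Banach yields a Lagrange multiplier s together with u
   submajorized by s w such that sum |y_i| x_i - ||H|| + s <= sum u_i phi(x_i)
   for all x, and k = 1/s, v = u/s are then optimal in the definition of the norm
   of y.

   ||F|| >= ||H|| + ||S||: the modular is subadditive on disjoint supports, and
   that of a far tail of z is negligible although S does not see the cut, so a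
   truncation of x that nearly norms H can be added to a tail of z that nearly
   norms S. *)

Require Import Defs.
From mathcomp Require Import all_boot all_order all_algebra.
From mathcomp Require Import all_classical all_reals all_analysis.
From mathcomp Require Import ring lra.
Import Order.TTheory GRing.Theory Num.Theory.
Import numFieldNormedType.Exports.
Local Open Scope classical_set_scope.
Local Open Scope ring_scope.

Set Implicit Arguments.
Unset Strict Implicit.
Unset Printing Implicit Defensive.

(** * The Hahn-Banach theorem for sublinear functionals *)

Section HahnBanach.
Context {R : realType} {V : lmodType R}.
Implicit Types p q : V -> R.

Definition sublinear p :=
  (forall x y, p (x + y) <= p x + p y) /\
  (forall (t : R) x, 0 < t -> p (t *: x) <= t * p x).

Lemma sublinear0 p : sublinear p -> p 0 = 0.
Proof.
move=> [pD pZ]; have := pD 0 0; have := pZ 2^-1 0 ltac:(by rewrite invr_gt0).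
by rewrite scaler0 addr0; lra.
Qed.

Lemma sublinearZ p t x : sublinear p -> 0 <= t -> p (t *: x) = t * p x.
Proof.
move=> sp; rewrite le_eqVlt => /predU1P[<-|t0].
  by rewrite scale0r mul0r sublinear0.
apply/eqP; rewrite eq_le sp.2//= -ler_pdivlMl//.
rewrite -[leLHS](_ : p (t^-1 *: (t *: x)) = _); last first.
  by rewrite scalerA mulVf ?scale1r ?gt_eqF.
by apply: sp.2; rewrite invr_gt0.
Qed.

Lemma sublinearN p x : sublinear p -> - p (- x) <= p x.
Proof. by move=> sp; have := sp.1 x (- x); rewrite subrr sublinear0//; lra. Qed.

Definition ray_inf q (v x : V) : R :=
  inf [set q (x + t *: v) - t * q v | t in [set t : R | 0 <= t]].

Section RayInf.
Variables (q : V -> R) (v : V).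
Hypothesis sq : sublinear q.

Lemma ray_inf_lbound x :
  has_lbound [set q (x + t *: v) - t * q v | t in [set t : R | 0 <= t]].
Proof.
exists (- q (- x)) => _ [t t0 <-].
have := sq.1 (x + t *: v) (- x).
by rewrite addrAC subrr add0r (sublinearZ _ sq t0); lra.
Qed.

Lemma ray_inf_le x t : 0 <= t -> ray_inf q v x <= q (x + t *: v) - t * q v.
Proof. by move=> t0; apply: ge_inf; [exact: ray_inf_lbound|exists t]. Qed.

Lemma le_ray_inf x c :
  (forall t, 0 <= t -> c <= q (x + t *: v) - t * q v) -> c <= ray_inf q v x.
Proof.
move=> h; apply: lb_le_inf; last by move=> _ [t t0 <-]; exact: h.
by exists (q (x + 0 *: v) - 0 * q v), 0 => /=.
Qed.

(** Admissible parameters form a cone: parameters [t] for [x] and [u] for [y] combine to [t + u] for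
    [x + y], and scaling [x] scales its parameter. *)
Lemma ray_inf_sublinear : sublinear (ray_inf q v).
Proof.
split=> [x y|t x t0].
  rewrite -lerBlDr; apply: le_ray_inf => t t0; rewrite lerBlDr -lerBlDl.
  apply: le_ray_inf => u u0; rewrite lerBlDl.
  apply: (le_trans (ray_inf_le _ (addr_ge0 t0 u0))).
  rewrite scalerDl addrACA; have := sq.1 (x + t *: v) (y + u *: v).
  by rewrite mulrDl; lra.
rewrite -ler_pdivrMl//; apply: le_ray_inf => u u0; rewrite ler_pdivrMl//.
apply: (le_trans (ray_inf_le _ (mulr_ge0 (ltW t0) u0))).
by rewrite -scalerA -scalerDr mulrBr mulrA lerD2r; exact: sq.2.
Qed.

End RayInf.

(** Zorn's lemma for the reversed pointwise order on sublinear functionals below [p]. A chain is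
    bounded by its pointwise infimum, which is finite because every member is at least [- p (- x)]
    at [x]. *)
Lemma exists_minimal_sublinear p : sublinear p -> exists q,
  [/\ sublinear q, forall x, q x <= p x &
      forall q', sublinear q' -> (forall x, q' x <= q x) -> q' = q].
Proof.
move=> sp.
pose T := {q : V -> R | sublinear q /\ forall x, q x <= p x}.
pose r : rel T := fun t1 t2 => `[< forall x, sval t2 x <= sval t1 x >].
have [| | |A totA|[q [sq qp]] qmin] := @Zorn T r.
- by move=> q; apply/asboolP.
- move=> q1 q2 q3 /asboolP h12 /asboolP h23; apply/asboolP => x.
  exact: le_trans (h23 x) (h12 x).
- move=> [q1 p1] [q2 p2] /asboolP/= h12 /asboolP/= h21; apply/eq_exist/funext => x.
  by apply/eqP; rewrite eq_le h21 h12.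
(* The empty chain is bounded by [p] itself. *)
- have [[q0 Aq0]|A0] := pselect (A !=set0); last first.
    exists (exist _ p (conj sp (fun x => lexx _))) => q Aq.
    by case: A0; exists q.
  pose B x := [set sval t x | t in A].
  have lbB x : has_lbound (B x).
    exists (- p (- x)) => _ [[q [sq qp]] Aq <-] /=.
    by apply: le_trans (sublinearN x sq); rewrite lerN2.
  have infB_le x t : A t -> inf (B x) <= sval t x.
    by move=> At; apply: ge_inf => //; exists t.
  have le_infB x c : (forall t, A t -> c <= sval t x) -> c <= inf (B x).
    move=> h; apply: lb_le_inf; first by exists (sval q0 x), q0.
    by move=> _ [q Aq <-]; exact: h.
  have sB : sublinear (fun x => inf (B x)) /\ forall x, inf (B x) <= p x.
    split; last by move=> x; apply: (le_trans (infB_le x _ Aq0)); exact: (proj2 (proj2_sig q0)).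
    split=> [x y|t x t0].
      rewrite -lerBlDr; apply: (le_infB _ _) => q1 Aq1; rewrite lerBlDr -lerBlDl.
      apply: (le_infB _ _) => q2 Aq2; rewrite lerBlDl.
      (* The smaller of the two members serves for both [x] and [y]. *)
      have [/asboolP h|/asboolP h] := totA _ _ Aq1 Aq2.
        apply: (le_trans (infB_le _ _ Aq2)).
        by apply: (le_trans ((proj1 (proj2_sig q2)).1 x y)); rewrite lerD2r.
      apply: (le_trans (infB_le _ _ Aq1)).
      by apply: (le_trans ((proj1 (proj2_sig q1)).1 x y)); rewrite lerD2l.
    rewrite -ler_pdivrMl//; apply: (le_infB _ _) => q Aq; rewrite ler_pdivrMl//.
    by apply: (le_trans (infB_le _ _ Aq)); exact: (proj1 (proj2_sig q)).2.
  exists (exist (fun q => sublinear q /\ forall x, q x <= p x) _ sB) => q Aq.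
  by apply/asboolP => x; exact: infB_le.
exists q; split=> // q' sq' q'q.
have q'p x : q' x <= p x by exact: le_trans (qp x).
have := qmin (exist _ q' (conj sq' q'p)) ltac:(by apply/asboolP).
by case.
Qed.

(* A minimal sublinear functional [q] equals all its [ray_inf q v], which makes
   it superadditive as well. *)
Lemma hahn_banach p : sublinear p -> exists f : V -> R,
  (forall (a : R) x y, f (a *: x + y) = a * f x + f y) /\ forall x, f x <= p x.
Proof.
move=> /exists_minimal_sublinear[q [sq qp qmin]]; exists q; split=> //.
have qD x v : q (x + v) = q x + q v.
  apply/eqP; rewrite eq_le sq.1/= -lerBrDr.
  have rq : ray_inf q v = q.
    apply: qmin; first exact: ray_inf_sublinear.
    by move=> z; have := ray_inf_le v sq z (lexx 0); rewrite scale0r addr0 mul0r subr0.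
  by have := ray_inf_le v sq x ler01; rewrite rq scale1r mul1r.
have qN x : q (- x) = - q x.
  by have := qD x (- x); rewrite subrr sublinear0//; lra.
move=> a x y; rewrite qD; congr (_ + _).
have [a0|a0] := leP 0 a; first exact: sublinearZ.
by rewrite -[a]opprK scaleNr qN (sublinearZ _ sq) ?mulNr// oppr_ge0 ltW.
Qed.

End HahnBanach.

(** * Weighted sums and Orlicz functions *)

Section WeightedSums.
Context {R : realType}.
Implicit Types (w a : nat -> R) (s : seq nat).

(** The weight goes with the position in the list, not with the index. For decreasing [w], listing
    the largest values of [a] first gives the largest sums, so a supremum over duplicate-free lists
    replaces the rearrangement of [a]. *)
Definition wsum w a s : R := \sum_(j < size s) a (nth 0%N s j) * w j.

Lemma wsum_cons w a i s :
  wsum w a (i :: s) = a i * w 0%N + wsum (fun j => w j.+1) a s.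
Proof. by rewrite /wsum /= big_ord_recl. Qed.

Lemma wsum_cat w a s t :
  wsum w a (s ++ t) = wsum w a s + wsum (fun j => w (size s + j)%N) a t.
Proof.
elim: s w => [|i s ih] w /=; first by rewrite [wsum w a [::]]/wsum big_ord0 add0r.
by rewrite !wsum_cons ih addrA.
Qed.

Lemma ler_wsum w a b s : (forall j, 0 <= w j) ->
  (forall i, i \in s -> a i <= b i) -> wsum w a s <= wsum w b s.
Proof.
by move=> w0 ab; apply: ler_sum => j _; apply: ler_wpM2r; rewrite ?ab ?mem_nth.
Qed.

Lemma wsumD w a b s : wsum w (fun i => a i + b i) s = wsum w a s + wsum w b s.
Proof. by rewrite -big_split; apply: eq_bigr => j _; rewrite mulrDl. Qed.

Lemma wsumZ w c a s : wsum w (fun i => c * a i) s = c * wsum w a s.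
Proof. by rewrite mulr_sumr; apply: eq_bigr => j _; rewrite mulrA. Qed.

Lemma wsum_index w a s : uniq s ->
  wsum w a s = \sum_(i <- s) a i * w (index i s).
Proof.
move=> us; rewrite (big_nth 0%N) big_mkord.
by apply: eq_bigr => j _; rewrite index_uniq.
Qed.

Lemma ler_wsum_weight w w' a s : (forall i, 0 <= a i) -> (forall j, w j <= w' j) ->
  wsum w a s <= wsum w' a s.
Proof. by move=> a0 ww; apply: ler_sum => j _; apply: ler_wpM2l. Qed.

(** Dropping entries where [a] vanishes moves the remaining ones to earlier positions, where the
    weights are larger. *)
Lemma wsum_filter w a (P : pred nat) s :
    (forall j, 0 <= w j) -> (forall j, w j.+1 <= w j) ->
    (forall i, 0 <= a i) -> (forall i, ~~ P i -> a i = 0) ->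
  wsum w a s <= wsum w a [seq i <- s | P i].
Proof.
move=> + + a0 aP; elim: s w => [|i s ih] w w0 wS //=.
have /= h := ih (fun j => w j.+1) (fun j => w0 j.+1) (fun j => wS j.+1).
rewrite wsum_cons; case: ifPn => iP; first by rewrite wsum_cons lerD2l.
by rewrite aP// mul0r add0r (le_trans h)// ler_wsum_weight.
Qed.

(** Among [n.+1] distinct indices one is at least [n]; its weight is at most [w n], and induction
    handles the others. *)
Lemma sum_weight_le w s : (forall j, w j.+1 <= w j) -> uniq s ->
  \sum_(i <- s) w i <= \sum_(j < size s) w j.
Proof.
move=> /nonincreasing_seqP wS.
move sn : (size s) => n; elim: n s sn => [|n ih] s sn us.
  by rewrite (size0nil sn) big_nil big_ord0.
have [k ks nk] : exists2 k, k \in s & (n <= k)%N.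
  apply: contrapT => h.
  suff : (size s <= size (iota 0 n))%N by rewrite size_iota sn ltnn.
  apply: uniq_leq_size => // k ks; rewrite mem_iota leq0n add0n ltnNge /=.
  by apply/negP => nk; apply: h; exists k.
rewrite (big_rem k) //= big_ord_recr /= addrC; apply: lerD; last exact: wS.
by apply: ih; rewrite ?size_rem ?sn ?rem_uniq.
Qed.

(** Summation by parts: the partial sums of [w - v] are nonnegative, so replacing the factor [a m]
    by the smaller [a m.+1] only lowers the bound carried by the induction. *)
Lemma abel_ler n (a v w : nat -> R) :
    (forall j, (j < n)%N -> 0 <= a j) ->
    (forall j, (j.+1 < n)%N -> a j.+1 <= a j) ->
    (forall m, (m <= n)%N -> \sum_(j < m) v j <= \sum_(j < m) w j) ->
  \sum_(j < n) a j * v j <= \sum_(j < n) a j * w j.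
Proof.
case: n => [|n] a0 aS vw; first by rewrite !big_ord0.
rewrite -subr_ge0 -sumrB.
have {vw} D m : (m <= n.+1)%N -> 0 <= \sum_(j < m) (w j - v j).
  by move=> /vw; rewrite sumrB subr_ge0.
suff h m : (m < n.+1)%N ->
    a m * (\sum_(j < m.+1) (w j - v j)) <= \sum_(j < m.+1) (a j * w j - a j * v j).
  by apply: le_trans (h n _) => //; apply: mulr_ge0; [exact: a0|exact: D].
elim: m => [|m ih] mn; first by rewrite !big_ord_recr !big_ord0 /= !add0r mulrBr.
rewrite big_ord_recr [leRHS]big_ord_recr /= mulrDr mulrBr lerD2r.
apply: le_trans (ih (ltnW mn)).
by apply: ler_wpM2r; [apply: D; exact: ltnW|exact: aS].
Qed.

End WeightedSums.

Section OrliczFunctionTheory.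
Context {R : realType} (phi : R -> R).
Hypothesis ophi : orlicz_function phi.

Lemma orlicz_ge0 t : 0 <= t -> 0 <= phi t.
Proof. by case: ophi => _ h _ _; exact: h. Qed.

Lemma orlicz0 : phi 0 = 0.
Proof. by case: ophi. Qed.

Lemma orlicz_convex t x y : 0 <= t <= 1 -> 0 <= x -> 0 <= y ->
  phi (t * x + (1 - t) * y) <= t * phi x + (1 - t) * phi y.
Proof.
move=> t01 x0 y0; case: ophi => cphi _ _ _.
have := cphi (Itv01 (andP t01).1 (andP t01).2) x y.
by rewrite !inE !convRE /=; apply.
Qed.

Lemma orlicz_scale t x : 0 <= t <= 1 -> 0 <= x -> phi (t * x) <= t * phi x.
Proof.
by move=> t01 x0; have := orlicz_convex t01 x0 (lexx 0); rewrite orlicz0 !mulr0 !addr0.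
Qed.

Lemma orlicz_le x y : 0 <= x -> x <= y -> phi x <= phi y.
Proof.
move=> x0; rewrite le_eqVlt => /predU1P[->//|xy].
have y0 : 0 < y by exact: le_lt_trans xy.
have r01 : 0 <= x / y <= 1.
  by rewrite divr_ge0 ?(ltW y0)//= ler_pdivrMr ?mul1r ?ltW.
have := orlicz_scale r01 (ltW y0); rewrite divfK ?gt_eqF// => /le_trans; apply.
by rewrite -[leRHS]mul1r ler_wpM2r ?orlicz_ge0 ?(ltW y0)//; case/andP: r01.
Qed.

End OrliczFunctionTheory.

(** * Decreasing rearrangements and the modular *)

Lemma seq_nat_ubound (s : seq nat) : exists m, {in s, forall i, (i < m)%N}.
Proof. by exists (\max_(i <- s) i).+1 => i si; rewrite ltnS (@leq_bigmax_seq _ s xpredT id). Qed.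

Section Rearrangement.
Context {R : realType}.
Implicit Types (x : nat -> R) (s : seq nat).
Local Open Scope ereal_scope.

Lemma size_le_counting s (A : set nat) : uniq s -> {in s, forall i, A i} ->
  (size s)%:R%:E <= counting A :> \bar R.
Proof.
move=> us sA; rewrite /counting; case: asboolP => [fA|_]; last exact: leey.
rewrite lee_fin ler_nat; apply: uniq_leq_size => //.
by move=> i /sA Ai; rewrite in_fset_set// inE.
Qed.

Lemma counting_le_size s (A : set nat) : (forall i, A i -> i \in s) ->
  counting A <= (size s)%:R%:E :> \bar R.
Proof.
move=> As; have fA : finite_set A.
  by apply: (sub_finite_set As); exact: finite_seq.
rewrite /counting asboolT// lee_fin ler_nat.
apply: uniq_leq_size; first exact: finmap.fset_uniq.
by move=> i; rewrite in_fset_set// inE => /As.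
Qed.

Lemma rearrangement_ge0 x i : 0 <= rearrangement x i.
Proof. by apply: le_ereal_inf_tmp => _ [l [l0 _] <-]; rewrite lee_fin ltW. Qed.

Lemma le_rearrangement x y i : (forall k, `|x k| <= `|y k|)%R ->
  rearrangement x i <= rearrangement y i.
Proof.
move=> xy; apply: ereal_inf_le_tmp => _ [l [l0 yl] <-]; exists l => //; split=> //.
apply: le_lt_trans yl; apply: le_measure; rewrite ?inE//= => k /=.
by move=> /lt_le_trans; exact.
Qed.

(** A level [l] below the entry of position [j] is exceeded by the first [j.+1] entries of [s], so
    [l] is not admissible in the infimum. *)
Lemma le_rearrangement_sorted x s j :
    sorted (fun i k => `|x k| <= `|x i|)%R s -> uniq s -> (j < size s)%N ->
  `|x (nth 0%N s j)|%:E <= rearrangement x j.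
Proof.
move=> ss us js; apply: le_ereal_inf_tmp => _ [l [l0 dl] <-]; rewrite lee_fin.
rewrite leNgt; apply/negP => lx; move: dl; apply/negP; rewrite -leNgt.
rewrite -[j.+1](size_takel js); apply: size_le_counting; first exact: take_uniq.
move=> i /(nthP 0%N)[k]; rewrite size_takel// => kj <-; rewrite nth_take//=.
apply: lt_le_trans lx _; apply: (sorted_leq_nth _ _ _ ss) => //.
- by move=> a b c h1 h2; exact: le_trans h2 h1.
- by rewrite inE (leq_trans kj).
Qed.

(** Otherwise at most [size s] entries exceed [r], and every level [r + e] is admissible in the
    infimum. *)
Lemma lt_rearrangement_fresh x s (r : R) : r%:E < rearrangement x (size s) ->
  exists2 i, i \notin s & (r < `|x i|)%R.
Proof.
move=> rx; apply: contrapT => h.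
have xr i : i \notin s -> (`|x i| <= r)%R.
  by move=> si; rewrite leNgt; apply/negP => ri; apply: h; exists i.
have r0 : (0 <= r)%R.
  have [m sm] := seq_nat_ubound s; apply: le_trans (xr m _) => //.
  by apply/negP => /sm; rewrite ltnn.
move: rx; apply/negP; rewrite -leNgt; apply/lee_addgt0Pr => e e0.
apply: ereal_inf_lbound; exists (r + e)%R => //; split; first exact: ltr_wpDl.
apply: le_lt_trans (counting_le_size (s := s) _) _; last by rewrite lte_fin ltr_nat.
move=> i /= ri; apply: contraLR ri => /xr; rewrite -leNgt => /le_trans; apply.
by rewrite lerDl ltW.
Qed.

(* The factor [t] is needed because a rearrangement need not be attained. *)
Lemma rearrangement_approx x (t : R) n : (0 < t < 1)%R ->
    (forall j, rearrangement x j < +oo) ->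
  exists s, [/\ uniq s, size s = n &
    forall j, (j < n)%N -> t%:E * rearrangement x j <= `|x (nth 0%N s j)|%:E].
Proof.
move=> /andP[t0 t1] xoo; elim: n => [|n [s [us sn hs]]]; first by exists [::].
have rn : rearrangement x n \is a fin_num.
  by rewrite ge0_fin_numE ?rearrangement_ge0.
have [i si hi] : exists2 i, i \notin s & t%:E * rearrangement x n <= `|x i|%:E.
  have := rearrangement_ge0 x n; rewrite le_eqVlt => /predU1P[x0|x0].
    have [m sm] := seq_nat_ubound s; exists m; last by rewrite -x0 mule0 lee_fin.
    by apply/negP => /sm; rewrite ltnn.
  rewrite -(fineK rn) -EFinM.
  have [|i si xi] :=
    @lt_rearrangement_fresh x s (t * fine (rearrangement x n)).
    by rewrite sn -[ltRHS](fineK rn) lte_fin gtr_pMl// -lte_fin fineK.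
  by exists i => //; rewrite lee_fin ltW.
exists (rcons s i); split; first by rewrite rcons_uniq si.
  by rewrite size_rcons sn.
move=> j; rewrite ltnS leq_eqVlt nth_rcons sn => /predU1P[->|jn].
  by rewrite ltnn eqxx.
by rewrite jn hs.
Qed.

End Rearrangement.

Section Modular.
Context {R : realType}.
Implicit Types (w v x : nat -> R) (s : seq nat).

Lemma nneseries_le_bound (f : nat -> \bar R) (B : \bar R) : (forall i, 0 <= f i)%E ->
  (forall n, \sum_(i < n) f i <= B)%E -> (\sum_(0 <= i <oo) f i <= B)%E.
Proof.
move=> f0 fB; apply: lime_le; first by apply: is_cvg_nneseries => n _ _; exact: f0.
by apply: nearW => n; rewrite big_mkord.
Qed.

Lemma nneseries_ge_partial (f : nat -> \bar R) n : (forall i, 0 <= f i)%E ->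
  (\sum_(i < n) f i <= \sum_(0 <= i <oo) f i)%E.
Proof.
move=> f0; rewrite -(big_mkord xpredT); apply: nneseries_lim_ge => i _ _; exact: f0.
Qed.

Lemma weight_ge0 w : weight w -> forall j, 0 <= w j.
Proof. by move=> [w0 _ _] j; exact: ltW. Qed.

Lemma weightS w : weight w -> forall j, w j.+1 <= w j.
Proof. by move=> [_ wS _]; apply/nonincreasing_seqP. Qed.

Lemma weight_unbounded w B : weight w -> exists n, B < \sum_(j < n) w j.
Proof.
move=> ww; apply: contrapT => h; case: (ww) => _ _ woo.
suff : (\sum_(0 <= i <oo) (w i)%:E <= B%:E)%E by rewrite woo.
apply: nneseries_le_bound => [i|n]; first by rewrite lee_fin weight_ge0.
by rewrite sumEFin lee_fin leNgt; apply/negP => Bn; apply: h; exists n.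
Qed.

(** Submajorization tested on finite sets of indices, hence free of rearrangements. For nonnegative
    [v] the next two lemmas show it equivalent to [submajorized]. *)
Definition subweight w v := (forall i, 0 <= v i) /\
  forall s, uniq s -> \sum_(i <- s) v i <= \sum_(j < size s) w j.

Let abs_ge x : rel nat := fun i k => `|x k| <= `|x i|.

Let sort_abs_sorted x s : sorted (abs_ge x) (sort (abs_ge x) s).
Proof. by apply: sort_sorted => i k; exact: le_total. Qed.

Lemma submajorized_subweight w v : (forall i, 0 <= v i) -> submajorized v w ->
  subweight w v.
Proof.
move=> v0 vw; split=> // s us; pose s' := sort (abs_ge v) s.
have us' : uniq s' by rewrite sort_uniq.
rewrite (perm_big s') /=; last by rewrite perm_sym perm_sort.
rewrite -lee_fin -[size s](size_sort (abs_ge v)) -/s' -!sumEFin.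
apply: le_trans (vw _); rewrite (big_nth 0%N) big_mkord; apply: lee_sum => j _.
rewrite -[v _]ger0_norm//; exact: le_rearrangement_sorted (sort_abs_sorted _ _) us' _.
Qed.

(** One-element lists bound [v] by [w 0], so its rearrangement is finite and is attained up to a
    factor [t < 1] on distinct indices; then [t] tends to 1. *)
Lemma subweight_submajorized w v : subweight w v -> submajorized v w.
Proof.
move=> [v0 vw] n.
have v1 i : `|v i| <= w 0%N.
  by have := vw [:: i] isT; rewrite big_seq1 big_ord1 ger0_norm.
have w1 : 0 < w 0%N + 1 by rewrite ltr_wpDl// (le_trans _ (v1 0%N)).
have voo j : (rearrangement v j < +oo)%E.
  apply: le_lt_trans (ltry (w 0%N + 1)); apply: ereal_inf_lbound.
  exists (w 0%N + 1) => //; split=> //.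
  apply: le_lt_trans (counting_le_size (s := [::]) _) _; last by rewrite lte_fin ltr_nat.
  by move=> i /=; rewrite ltNge (le_trans (v1 i)) ?lerDl.
have rfin j : rearrangement v j \is a fin_num.
  by rewrite ge0_fin_numE ?rearrangement_ge0.
rewrite (eq_bigr (fun i : 'I_n => (fine (rearrangement v i))%:E)); last first.
  by move=> i _; rewrite fineK.
rewrite !sumEFin lee_fin.
suff h t : 0 < t < 1 -> t * \sum_(i < n) fine (rearrangement v i) <= \sum_(i < n) w i.
  have [r0|r0] := leP (\sum_(i < n) fine (rearrangement v i)) 0.
    have := vw (iota 0 n) (iota_uniq _ _); rewrite size_iota.
    by apply: le_trans; rewrite (le_trans r0) ?sumr_ge0.
  rewrite leNgt; apply/negP => wr.
  set r := \sum_(i < n) _ in h r0 wr; set W := \sum_(i < n) _ in h wr.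
  have W0 : 0 <= W.
    by have := vw (iota 0 n) (iota_uniq _ _); rewrite size_iota; apply: le_trans; exact: sumr_ge0.
  (* The midpoint of [W / r] and 1 is a factor below 1 whose product with [r] exceeds [W]. *)
  have := h ((W / r + 1) / 2).
  have : W / r < 1 by rewrite ltr_pdivrMr ?mul1r.
  have : 0 <= W / r by rewrite divr_ge0// ltW.
  have : W / r * r = W by rewrite divfK// gt_eqF.
  by move: (W / r) => q qr q0 q1 /(_ ltac:(lra)); nra.
move=> t01; have [s [us sn hs]] := rearrangement_approx n t01 voo.
have := vw s us; rewrite sn; apply: le_trans.
rewrite mulr_sumr (big_nth 0%N) big_mkord sn; apply: ler_sum => j _.
by have := hs j (ltn_ord j); rewrite -(fineK (rfin j)) -EFinM lee_fin ger0_norm.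
Qed.

(** Distinct entries have distinct positions in [s], so [sum_weight_le] applies to the positions.
    This turns a [wsum] along [s] into a sum against a subweight. *)
Lemma index_subweight w s : weight w -> uniq s ->
  subweight w (fun i => if i \in s then w (index i s) else 0).
Proof.
move=> ww us; have w0 := weight_ge0 ww; split=> [i|t ut]; first by case: ifP.
rewrite -big_mkcond /= -big_filter -(big_map (index^~ s) xpredT w).
set t' := [seq _ | _ <- _]; have ut' : uniq t'.
  rewrite map_inj_in_uniq ?filter_uniq// => i k; rewrite !mem_filter.
  move=> /andP[si _] /andP[sk _] e.
  by rewrite -(nth_index 0%N si) e nth_index.
apply: le_trans (sum_weight_le (weightS ww) ut') _.
have tt : (size t' <= size t)%N by rewrite size_map size_filter count_size.
rewrite -(subnKC tt) big_split_ord /= lerDl; exact: sumr_ge0.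
Qed.

Section OrliczModular.
Context (phi : R -> R) (w : nat -> R).
Hypotheses (ophi : orlicz_function phi) (ww : weight w).

Let w0 : forall j, 0 <= w j := weight_ge0 ww.

Lemma er_map_orlicz_le (a b : \bar R) : (0 <= a -> a <= b -> er_map phi a <= er_map phi b)%E.
Proof.
move: a b => [a||] [b||]//=; rewrite ?lee_fin ?leey//.
exact: orlicz_le.
Qed.

Lemma er_map_orlicz_ge0 (a : \bar R) : (0 <= a -> 0 <= er_map phi a)%E.
Proof. by move: a => [a||]//=; rewrite !lee_fin; exact: orlicz_ge0. Qed.

Lemma modular_term_ge0 x i : (0 <= er_map phi (rearrangement x i) * (w i)%:E)%E.
Proof. by rewrite mule_ge0 ?lee_fin// er_map_orlicz_ge0// rearrangement_ge0. Qed.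

Lemma modular_ge0 x : (0 <= modular phi w x)%E.
Proof. by apply: nneseries_ge0 => i _ _; exact: modular_term_ge0. Qed.

Lemma le_modular x y : (forall i, `|x i| <= `|y i|) ->
  (modular phi w x <= modular phi w y)%E.
Proof.
move=> xy; apply: lee_nneseries => [i _ _|i _]; first exact: modular_term_ge0.
rewrite lee_wpmul2r ?lee_fin// er_map_orlicz_le ?rearrangement_ge0//.
exact: le_rearrangement.
Qed.

(** After sorting [s] by decreasing absolute value, Abel summation replaces [v] by [w], and each
    sorted entry is at most the rearrangement at its position. *)
Lemma subweight_sum_le_modular x v s : subweight w v -> uniq s ->
  ((\sum_(i <- s) phi `|x i| * v i)%:E <= modular phi w x)%E.
Proof.
move=> [v0 vw] us; pose s' := sort (abs_ge x) s.
have us' : uniq s' by rewrite sort_uniq.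
have ss' : sorted (abs_ge x) s' by exact: sort_abs_sorted.
apply: le_trans (nneseries_ge_partial (size s') (modular_term_ge0 x)).
rewrite (perm_big s') /=; last by rewrite perm_sym perm_sort.
rewrite (big_nth 0%N) big_mkord.
apply: (@le_trans _ _ (\sum_(j < size s') phi `|x (nth 0%N s' j)| * w j)%:E).
  rewrite lee_fin.
  apply: (@abel_ler _ _ (fun j => phi `|x (nth 0%N s' j)|)
    (fun j => v (nth 0%N s' j))) => [j _|j js|m ms].
  - by rewrite orlicz_ge0.
  - apply: (orlicz_le ophi) => //; apply: (sorted_leq_nth _ _ _ ss') => //.
    + by move=> a b c h1 h2; exact: le_trans h2 h1.
    + by move=> a; exact: lexx.
    + by rewrite inE ltnW.
  - have := vw (take m s') (take_uniq _ us'); rewrite size_takel//; apply: le_trans.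
    rewrite (big_nth 0%N) big_mkord size_takel//.
    by apply: ler_sum => j _; rewrite nth_take.
rewrite -sumEFin; apply: lee_sum => j _.
rewrite EFinM lee_wpmul2r ?lee_fin//.
rewrite -[X in (X <= _)%E]/(er_map phi (`|x (nth 0%N s' j)|)%:E).
by rewrite er_map_orlicz_le ?lee_fin// le_rearrangement_sorted.
Qed.

(** The list form of the bound [B] on the modular: it follows from that bound, and implies it once
    [x] is scaled by some [t < 1]. *)
Definition modular_bound x (B : R) :=
  forall s, uniq s -> wsum w (fun i => phi `|x i|) s <= B.

Lemma modular_bound_of_modular x B : (modular phi w x <= B%:E)%E -> modular_bound x B.
Proof.
move=> xB s us; rewrite -lee_fin; apply: le_trans xB.
apply: le_trans (subweight_sum_le_modular x (index_subweight ww us) us).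
rewrite lee_fin wsum_index// le_eqVlt; apply/predU1P; left.
by rewrite big_seq [RHS]big_seq; apply: eq_bigr => i ->.
Qed.

Lemma modular_bound_unit_le x B i : modular_bound x B -> phi `|x i| * w 0%N <= B.
Proof. by move=> /(_ [:: i] isT); rewrite /wsum big_ord1. Qed.

Lemma modular_le_of_bound x B (t : R) : 0 < t < 1 -> modular_bound x B ->
  (modular phi w (fun i => t * x i)%R <= B%:E)%E.
Proof.
move=> t01 xB; have /andP[t0 t1] := t01; pose tx i := t * x i.
have phi1 : 0 < phi 1 by case: ophi => _ _ _; apply.
have w00 : 0 < w 0%N by case: ww.
have B0 : 0 <= B by have := xB [::] isT; rewrite /wsum big_ord0.
(* [C] bounds all entries of [x]: convexity gives [phi 1 * r <= phi r] for [r >= 1], and a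
   one-element list gives [phi r * w 0 <= B] for [r] the absolute value of an entry. The
   rearrangement is therefore finite. *)
pose C := 1 + B / (w 0%N * phi 1).
have C1 : 1 <= C by rewrite lerDl divr_ge0// mulr_ge0// ltW.
have xC i : `|x i| <= C.
  have [|x1] := leP `|x i| 1; first by move/le_trans; exact.
  suff : phi 1 * `|x i| <= phi `|x i|.
    move=> h; apply: (@le_trans _ _ (B / (w 0%N * phi 1))); last by rewrite lerDr.
    rewrite ler_pdivlMr ?mulr_gt0//; apply: le_trans (modular_bound_unit_le i xB).
    by rewrite mulrCA mulrC; apply: ler_wpM2r => //; rewrite mulrC.
  have x0 : 0 < `|x i| by exact: lt_trans x1.
  have := orlicz_scale ophi (t := `|x i|^-1) (x := `|x i|) _ (ltW x0).
  rewrite mulVf ?gt_eqF// invr_ge0 ltW//= invf_le1// ltW// => /(_ isT).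
  by rewrite mulrC ler_pdivlMr//.
have txoo j : (rearrangement tx j < +oo)%E.
  apply: le_lt_trans (ltry (C + 1)); apply: ereal_inf_lbound.
  exists (C + 1) => //; split=> //; first lra.
  apply: le_lt_trans (counting_le_size (s := [::]) _) _; last by rewrite lte_fin ltr_nat.
  move=> i /=; rewrite ltNge; move/negP; case; rewrite /tx normrM gtr0_norm//.
  have := xC i; have := normr_ge0 (x i); nra.
have rfin j : rearrangement tx j \is a fin_num.
  by rewrite ge0_fin_numE ?rearrangement_ge0.
apply: nneseries_le_bound => [i|n]; first exact: modular_term_ge0.
(* The factor [t] lost in the approximation cancels against the scaling of [x]: the rearrangement of
   [tx] at [j] is at most the absolute value of the unscaled entry. *)
have [s [us sn hs]] := rearrangement_approx n t01 txoo.
rewrite -sn; apply: (@le_trans _ _ (wsum w (fun i => phi `|x i|) s)%:E); last first.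
  by rewrite lee_fin; exact: xB.
rewrite /wsum -sumEFin; apply: lee_sum => j _.
rewrite EFinM lee_wpmul2r ?lee_fin//.
rewrite -[X in (_ <= X)%E]/(er_map phi (`|x (nth 0%N s j)|)%:E).
rewrite er_map_orlicz_le ?rearrangement_ge0//.
have := hs j; rewrite -sn ltn_ord => /(_ isT).
rewrite -(fineK (rfin j)) -EFinM !lee_fin normrM gtr0_norm//.
by rewrite ler_pM2l.
Qed.

End OrliczModular.
End Modular.

(** * Lagrange multipliers *)

Section FinitelySupportedDuality.
Context {R : realType}.
Implicit Types (a c w : nat -> R) (x y : {poly R}).

Lemma sum_uniq_le (f : nat -> R) n s : (forall i, 0 <= f i) ->
  (forall i, (n <= i)%N -> f i = 0) -> uniq s ->
  \sum_(i <- s) f i <= \sum_(i < n) f i.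
Proof.
move=> f0 fn us.
rewrite (bigID (fun i => (i < n)%N)) /= addrC big1 ?add0r; last first.
  by move=> i; rewrite -leqNgt; exact: fn.
rewrite -big_filter (perm_big [seq i <- iota 0 n | i \in s]) /=; last first.
  apply: uniq_perm; rewrite ?filter_uniq ?iota_uniq// => i.
  by rewrite !mem_filter mem_iota add0n andbC.
rewrite big_filter big_mkcond -(big_mkord xpredT) /index_iota subn0.
by apply: ler_sum => i _; case: ifP.
Qed.

(* Polynomials stand for finitely supported sequences. *)
Definition pairing c x : R := \sum_(i < size x) c i * x`_i.

Lemma pairingE c x n : (size x <= n)%N -> pairing c x = \sum_(i < n) c i * x`_i.
Proof.
move=> xn; rewrite -(subnKC xn) big_split_ord /= [X in _ + X]big1 ?addr0// => i _.
by rewrite nth_default ?mulr0// leq_addr.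
Qed.

Lemma pairing_linear c k x y : pairing c (k *: x + y) = k * pairing c x + pairing c y.
Proof.
pose n := maxn (size (k *: x + y)) (maxn (size x) (size y)).
rewrite !(@pairingE c _ n) ?leq_max ?leqnn ?orbT//.
rewrite mulr_sumr -big_split; apply: eq_bigr => i _ /=.
by rewrite coefD coefZ mulrDr mulrCA.
Qed.

Lemma pairing0 c : pairing c 0 = 0.
Proof. by rewrite /pairing size_poly0 big_ord0. Qed.

Lemma pairingZ c k x : pairing c (k *: x) = k * pairing c x.
Proof. by have := pairing_linear c k x 0; rewrite addr0 pairing0 addr0. Qed.

Lemma linear_pairing (g : {poly R} -> R) :
  (forall k x y, g (k *: x + y) = k * g x + g y) ->
  forall x, g x = pairing (fun i => g 'X^i) x.
Proof.
move=> gl x.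
have g0 : g 0 = 0 by have := gl 1 0 0; rewrite scaler0 addr0 mul1r; lra.
rewrite /pairing -{1}(coefK x) poly_def.
have gD : {morph g : p q / p + q}.
  by move=> p q; have := gl 1 p q; rewrite scale1r mul1r.
rewrite (big_morph g gD g0); apply: eq_bigr => i _.
by have := gl x`_i 'X^i 0; rewrite !addr0 g0 addr0 mulrC.
Qed.

Lemma wsum_lbound w a n s : (forall j, 0 <= w j) -> (forall j, w j.+1 <= w j) ->
  (forall i, (n <= i)%N -> a i = 0) -> uniq s ->
  - (w 0%N * \sum_(i < n) `|a i|) <= wsum w a s <= w 0%N * \sum_(i < n) `|a i|.
Proof.
move=> w0 /nonincreasing_seqP wS an us; rewrite -ler_norml wsum_index//.
apply: (le_trans (ler_norm_sum _ _ _)).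
apply: (@le_trans _ _ (\sum_(i <- s) `|a i| * w 0%N)).
  by apply: ler_sum => i _; rewrite normrM ler_wpM2l// ger0_norm// wS.
rewrite -mulr_suml mulrC ler_wpM2l// sum_uniq_le// => i ni.
by rewrite an// normr0.
Qed.

Context (phi : R -> R) (w c : nat -> R) (M : R).
Hypotheses (ophi : orlicz_function phi) (ww : weight w).
Hypothesis pairing_le : forall x, (forall i, 0 <= x`_i) ->
  modular_bound phi w (nth 0 x) 1 -> pairing c x <= M.

Let w0 : forall j, 0 <= w j := weight_ge0 ww.

Let M0 : 0 <= M.
Proof.
rewrite -(pairing0 c); apply: pairing_le => [i|s us]; first by rewrite coef0.
rewrite (_ : wsum _ _ _ = 0) ?ler01// /wsum big1// => j _.
by rewrite coef0 normr0 orlicz0// mul0r.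
Qed.

(** The constraint that the modular be at most 1, perturbed by [v] and multiplied by [t]; [v = 0],
    [t = 1] is the original one. The extra variable [t] makes the problem positively homogeneous in
    [v]. *)
Let feasible (v : {poly R} * R^o) (t : R) x :=
  [/\ 0 <= t, forall i, 0 <= x`_i &
    forall s, uniq s -> wsum w (fun i => v.1`_i + t * phi x`_i) s <= v.2 + t].

(** It dominates every effect of the perturbation on the constraint, so that [x = 0] is feasible
    with [t = slack v]. *)
Let slack (v : {poly R} * R^o) : R := `|v.2| + w 0%N * \sum_(i < size v.1) `|v.1`_i|.

Let slack_ge0 v : 0 <= slack v.
Proof. by rewrite addr_ge0// mulr_ge0// sumr_ge0. Qed.

(** The modular of [x] is at most [(t + slack v) / t], so by convexity that of [k *: x] is at most 1
    for [k = t / (t + slack v)], and the hypothesis on [M] applies to [k *: x]. *)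
Let feasible_lbound v t x : feasible v t x -> - (M * slack v) <= t * (M - pairing c x).
Proof.
move=> [t0 x0 vx].
have := t0; rewrite le_eqVlt => /predU1P[<-|tp].
  by rewrite mul0r oppr_le0 mulr_ge0// slack_ge0.
have q0 : 0 <= slack v / t by rewrite divr_ge0// slack_ge0.
have [k [k0 kq]] : exists k, 0 < k <= 1 /\ k * (t + slack v) = t.
  exists (1 + slack v / t)^-1; split.
    by rewrite invr_gt0 ltr_wpDr//= invf_le1 ?ltr_wpDr// lerDl.
  rewrite (_ : t + slack v = (1 + slack v / t) * t); last by rewrite mulrDl mul1r divfK ?gt_eqF.
  by rewrite mulrA mulVf ?mul1r// gt_eqF// ltr_wpDr.
have kx i : 0 <= (k *: x)`_i by rewrite coefZ mulr_ge0//; lra.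
suff h : modular_bound phi w (nth 0 (k *: x)) 1.
  have := pairing_le kx h; rewrite pairingZ => kM.
  have /andP[kp _] := k0.
  suff : k * (t * pairing c x) <= k * (M * (t + slack v)) by rewrite ler_pM2l//; nra.
  by rewrite mulrCA [leRHS]mulrCA kq mulrC ler_pM2r.
move=> s us.
have := vx s us; rewrite wsumD wsumZ => vs.
have /andP[lb _] := wsum_lbound w0 (weightS ww) (fun i => @nth_default _ 0 v.1 i) us.
have tws : t * wsum w (fun i => phi x`_i) s <= t + slack v.
  by have := ler_norm v.2; rewrite /slack; lra.
apply: (@le_trans _ _ (k * wsum w (fun i => phi x`_i) s)).
  rewrite -wsumZ; apply: ler_wsum => // i _.
  by rewrite ger0_norm// coefZ; apply: orlicz_scale => //; lra.
have /andP[kp _] := k0.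
rewrite -(ler_pM2l tp) mulr1 mulrCA -[leRHS]kq.
by rewrite ler_pM2l.
Qed.

Let feasible_exists v : feasible v (slack v) 0.
Proof.
split=> [|i|s us]; [exact: slack_ge0|by rewrite coef0|].
have /andP[_ ub] := wsum_lbound w0 (weightS ww) (fun i => @nth_default _ 0 v.1 i) us.
rewrite wsumD [X in _ + X](_ : _ = 0); last first.
  by rewrite /wsum big1// => j _; rewrite coef0 orlicz0// mulr0 mul0r.
by have := ler_norm (- v.2); rewrite normrN /slack; lra.
Qed.

(** The witness is the convex combination of [x] and [x'] with coefficients proportional to [t] and
    [t']; convexity of [phi] keeps it feasible. If both vanish, [x] and [x'] do not matter and 0 is
    taken. *)
Let feasibleD v v' t t' x x' : feasible v t x -> feasible v' t' x' ->
  exists y, feasible (v + v') (t + t') y /\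
    (t + t') * pairing c y = t * pairing c x + t' * pairing c x'.
Proof.
move=> [t0 x0 vx] [t0' x0' vx'].
exists ((t + t')^-1 *: (t *: x + t' *: x')).
have [tt|tt] := eqVneq (t + t') 0.
  have te : t = 0 by lra.
  have te' : t' = 0 by lra.
  rewrite te te' !addr0 !mul0r addr0 invr0 scale0r; split=> //.
  split=> [//|i|s us]; first by rewrite coef0.
  rewrite te in vx; rewrite te' in vx'.
  have := lerD (vx s us) (vx' s us); rewrite -wsumD !addr0; apply: le_trans.
  by apply: ler_wsum => // i _; rewrite coefD !mul0r !addr0.
have tp : 0 < t + t' by rewrite lt_neqAle eq_sym tt addr_ge0.
have yE i : ((t + t')^-1 *: (t *: x + t' *: x'))`_i =
    t / (t + t') * x`_i + (1 - t / (t + t')) * x'`_i.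
  by rewrite coefZ coefD !coefZ; field.
have tt01 : 0 <= t / (t + t') <= 1.
  by rewrite divr_ge0 ?(ltW tp)//= ler_pdivrMr// mul1r lerDl.
split; last first.
  rewrite pairingZ mulrA mulfV// mul1r.
  by rewrite pairing_linear pairingZ.
split=> [|i|s us]; first exact: ltW.
  rewrite yE addr_ge0// mulr_ge0//; lra.
rewrite [leRHS](_ : _ = (v.2 + t) + (v'.2 + t')) /=; last by rewrite addrACA.
apply: le_trans (lerD (vx s us) (vx' s us)); rewrite -wsumD.
apply: ler_wsum => // i _; rewrite yE coefD.
have := ler_wpM2l (ltW tp) (orlicz_convex ophi tt01 (x0 i) (x0' i)).
rewrite [X in _ <= X -> _](_ : _ = t * phi x`_i + t' * phi x'`_i); last by field.
lra.
Qed.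

Let feasibleZ v t x k : 0 < k -> feasible v t x -> feasible (k *: v) (k * t) x.
Proof.
move=> k0 [t0 x0 vx]; split=> // [|s us]; first by rewrite mulr_ge0// ltW.
rewrite [leRHS](_ : _ = k * (v.2 + t)); last by rewrite mulrDr.
apply: le_trans (_ : _ <= k * wsum w (fun i => v.1`_i + t * phi x`_i) s) _.
  rewrite -wsumZ le_eqVlt; apply/predU1P; left.
  by apply: eq_bigr => j _; rewrite coefZ mulrDr mulrA.
by rewrite ler_pM2l// vx.
Qed.

(** The optimal value of the perturbed problem. A linear functional below it supplies the
    multipliers. *)
Let value v : R := inf [set r | exists t x, feasible v t x /\ r = t * (M - pairing c x)].

Let value_le v t x : feasible v t x -> value v <= t * (M - pairing c x).
Proof.
move=> vx; apply: ge_inf; last by exists t, x.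
by exists (- (M * slack v)) => _ [t' [x' [vx' ->]]]; exact: feasible_lbound.
Qed.

Let le_value v k : (forall t x, feasible v t x -> k <= t * (M - pairing c x)) ->
  k <= value v.
Proof.
move=> h; apply: lb_le_inf; last by move=> _ [t [x [vx ->]]]; exact: h.
by exists (slack v * (M - pairing c 0)), (slack v), 0; split=> //; exact: feasible_exists.
Qed.

Let value_sublinear : sublinear value.
Proof.
split=> [v v'|k v k0].
  rewrite -lerBlDr; apply: (le_value _) => t x vx; rewrite lerBlDr -lerBlDl.
  apply: (le_value _) => t' x' vx'; rewrite lerBlDl.
  have [y [vy yE]] := feasibleD vx vx'.
  apply: (le_trans (value_le vy)).
  by rewrite mulrBr yE; lra.
rewrite -ler_pdivrMl//; apply: (le_value _) => t x vx; rewrite ler_pdivrMl// mulrA.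
exact: value_le (feasibleZ k0 vx).
Qed.

(* [s] is the Lagrange multiplier of the constraint that the modular be at most
   1, and [u] is one of the linear functionals whose supremum is [s] times the
   modular, as a function of [phi \o x]. *)
Lemma lagrange_multiplier : exists s u,
  [/\ 0 <= s, subweight (fun j => s * w j) u &
    forall x, (forall i, 0 <= x`_i) ->
      pairing c x - M + s <= \sum_(i < size x) u i * phi x`_i].
Proof.
have [f [fl fle]] := hahn_banach value_sublinear.
pose g (p : {poly R}) := f (p, 0); pose s := - f (0, 1); pose u i := g 'X^i.
have f0 : f 0 = 0 by have := fl 1 0 0; rewrite scaler0 addr0 mul1r; lra.
have fE p (r : R) : f (p, r) = g p - r * s.
  rewrite /g /s mulrN opprK -[(p, r)](_ : r *: (0, 1) + (p, 0) = _); last first.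
    by congr pair; rewrite /= ?scaler0 ?add0r// addr0 /GRing.scale /= mulr1.
  by rewrite fl addrC.
have gE p : g p = pairing u p.
  apply: linear_pairing => k x y; rewrite /g -fl; congr f.
  by congr pair; rewrite /= ?scaler0 ?addr0.
(* Such a perturbation is feasible with [t = 0], at cost 0. All the sign and size conditions on [s]
   and [u] are instances of this. *)
have f_le0 (p : {poly R}) r :
    (forall l, uniq l -> wsum w (nth 0 p) l <= r) -> g p <= r * s.
  move=> h; rewrite -subr_le0 -fE; apply: (le_trans (fle _)).
  rewrite -[leRHS](mul0r (M - pairing c 0)); apply: value_le; split=> // [i|l ul].
    by rewrite coef0.
  by rewrite wsumD (wsumZ w 0) mul0r !addr0; exact: h.
exists s, u; split.
- have := @f_le0 0 1; rewrite gE pairing0 mul1r; apply=> l _.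
  by rewrite /wsum big1 ?ler01// => j _; rewrite coef0 mul0r.
- split=> [i|l ul].
    have := @f_le0 (- 'X^i) 0; rewrite mul0r gE -scaleN1r pairingZ -gE mulN1r oppr_le0.
    apply=> l _; apply: sumr_le0 => j _.
    by rewrite coefZ coefXn mulN1r mulNr oppr_le0 mulr_ge0.
  rewrite -mulr_sumr mulrC.
  (* This polynomial is the indicator of [l]; its weighted sum along any list is at most the sum of
     the first [size l] weights. *)
  have -> : \sum_(i <- l) u i = g (\sum_(i <- l) 'X^i).
    rewrite gE; elim: l {ul} => [|i l ih]; first by rewrite !big_nil pairing0.
    by rewrite !big_cons -[X in pairing _ (X + _)]scale1r pairing_linear -gE mul1r ih.
  have lE k : (\sum_(i <- l) 'X^i : {poly R})`_k = (k \in l)%:R.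
    rewrite coef_sum (eq_bigr (fun i => (k == i)%:R)); last first.
      by move=> i _; rewrite coefXn.
    have [kl|kl] := boolP (k \in l).
      rewrite (bigD1_seq k) //= eqxx big1 ?addr0// => i /negbTE.
      by rewrite eq_sym => ->.
    rewrite big_seq big1// => i il; case: eqP => // ki.
    by rewrite ki il in kl.
  apply: f_le0 => l' ul'; rewrite wsum_index//.
  apply: le_trans (_ : _ <= \sum_(i <- l) (if i \in l' then w (index i l') else 0)) _.
    rewrite -big_mkcond -big_filter [leRHS](perm_big [seq i <- l' | i \in l]) /=; last first.
      apply: uniq_perm; rewrite ?filter_uniq// => i.
      by rewrite !mem_filter andbC.
    rewrite big_filter [leRHS]big_mkcond /=; apply: ler_sum => i _.
    by rewrite lE; case: ifP; rewrite ?mul1r ?mul0r.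
  exact: (index_subweight ww ul').2.
- move=> x x0; pose px := map_poly phi x.
  have pxE i : px`_i = phi x`_i by rewrite coef_map_id0// orlicz0.
  (* The perturbation cancels both sides of the constraint for this [x], which makes [x] feasible at
     cost [M - pairing c x]. *)
  have fx : feasible (- px, - 1) 1 x.
    split=> // l _; rewrite addNr (_ : wsum _ _ _ = 0)// /wsum big1// => j _.
    by rewrite coefN pxE mul1r addNr mul0r.
  have := le_trans (fle _) (value_le fx).
  rewrite fE mul1r gE -scaleN1r pairingZ (@pairingE u px (size x)); last exact: size_poly.
  under eq_bigr do rewrite pxE.
  by lra.
Qed.

End FinitelySupportedDuality.

(** * The Amemiya norm *)

Section Complementary.
Context {R : realType} (phi : R -> R).
Hypothesis nphi : N_function phi.

Let ophi : orlicz_function phi. Proof. by case: nphi. Qed.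

(** Superlinear growth of [phi] makes the terms nonpositive for [u] beyond some threshold, and below
    it they are at most the threshold times the absolute value of [v]. *)
Lemma complementary_has_ubound v :
  has_ubound [set u * v - phi u | u in [set u | 0 <= u]].
Proof.
case: nphi => _ _ /cvgryPge /(_ v)[A [_ hA]].
exists (`|A| * `|v|) => _ [u /= u0 <-].
have [uA|Au] := leP u `|A|.
  have := orlicz_ge0 ophi u0; have := ler_norm v; have := normr_ge0 v; nra.
have up : 0 < u by exact: le_lt_trans Au.
have /= := hA u (le_lt_trans (ler_norm _) Au); rewrite ler_pdivlMr// mulrC => uv.
by apply: (@le_trans _ _ 0); [rewrite subr_le0|rewrite mulr_ge0].
Qed.

Lemma young u v : 0 <= u -> u * v <= phi u + complementary phi v.
Proof.
by move=> u0; rewrite -lerBlDl; apply: ub_le_sup;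
  [exact: complementary_has_ubound|exists u].
Qed.

Lemma complementary_ge0 v : 0 <= complementary phi v.
Proof. by have := young v (lexx 0); rewrite mul0r orlicz0// add0r. Qed.

Lemma complementary_adherent v e : 0 < e ->
  exists2 u, 0 <= u & complementary phi v <= u * v - phi u + e.
Proof.
pose E := [set u * v - phi u | u in [set u | 0 <= u]].
move=> e0; have [|_ [u u0 <-]] := sup_adherent (E := E) e0.
  split; last exact: complementary_has_ubound.
  by exists (0 * v - phi 0), 0 => /=.
by rewrite ltrBlDr => /ltW h; exists u.
Qed.

Lemma p_term_ge0 (a b : R) : 0 <= b -> (0 <= p_term (complementary phi) a b)%E.
Proof.
move=> b0; rewrite /p_term; case: ifP => _; first by case: ifP.
by rewrite lee_fin mulr_ge0// complementary_ge0.
Qed.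

Lemma young_p_term (x a b : R) : 0 <= b ->
  ((`|x| * `|a|)%:E <= (phi `|x| * b)%:E + p_term (complementary phi) a b)%E.
Proof.
rewrite le_eqVlt /p_term => /predU1P[<-|b0].
  rewrite eqxx; case: eqP => [->|_]; first by rewrite normr0 !mulr0 adde0.
  by rewrite mulr0 add0e leey.
rewrite gt_eqF// -EFinD lee_fin -mulrDl -ler_pdivrMr// -mulrA.
exact: young.
Qed.

End Complementary.

Section Amemiya.
Context {R : realType} (phi : R -> R) (w : nat -> R).
Hypotheses (nphi : N_function phi) (ww : weight w).

Let ophi : orlicz_function phi. Proof. by case: nphi. Qed.
Let w0 : forall j, 0 <= w j := weight_ge0 ww.

Local Notation psi := (complementary phi).

(** For each competitor [v], Young's inequality is applied entrywise to [x] and [k * y]; the part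
    with [phi] is at most the modular of [x], hence at most 1. *)
Lemma pairing_le_p_modular (x y : nat -> R) (k : R) n : 0 < k -> (modular phi w x <= 1)%E ->
  ((\sum_(i < n) `|x i| * `|y i|)%:E <=
     (k^-1)%:E * (1 + p_modular psi w (fun i => k * y i)%R))%E.
Proof.
move=> k0 x1; rewrite muleC lee_pdivlMr// -leeBlDl//.
apply: le_ereal_inf_tmp => _ [v [v0 /(submajorized_subweight v0) vw] <-].
apply: le_trans (nneseries_ge_partial n (fun i => p_term_ge0 nphi _ (v0 i))).
rewrite leeBlDl//.
apply: (@le_trans _ _ ((\sum_(i < n) phi `|x i| * v i)%:E +
    \sum_(i < n) p_term psi (k * y i) (v i)))%E.
  rewrite -EFinM mulrC mulr_sumr -!sumEFin -big_split /=; apply: lee_sum => i _.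
  apply: le_trans (young_p_term nphi (x i) (k * y i) (v0 i)).
  by rewrite normrM (gtr0_norm k0) mulrCA.
rewrite leeD2r//; apply: le_trans x1.
have := subweight_sum_le_modular ophi ww x vw (iota_uniq 0 n).
by rewrite -[n in iota 0 n]subn0 -/(index_iota 0 n) big_mkord.
Qed.

Section UpperBound.
Context (y : nat -> R) (M : R).
Hypothesis pairing_le : forall x : {poly R}, (forall i, 0 <= x`_i) ->
  modular_bound phi w (nth 0 x) 1 -> pairing (fun i => `|y i|) x <= M.

(** The competitor is [k * u] with [k] the inverse of [s + e]; [e] covers the case [s = 0]. Taking
    suprema over [x] in the multiplier inequality bounds its cost by [k * (M - s)], which equals
    [k * (M + e) - 1]. *)
Lemma p_modular_le_pairing e : 0 < e -> exists2 k, 0 < k &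
  (p_modular psi w (fun i => k * y i)%R <= (k * (M + e) - 1)%:E)%E.
Proof.
move=> e0; have [s [u [s0 [u0 uw] hs]]] := lagrange_multiplier ophi ww pairing_le.
have se : 0 < s + e by rewrite ltr_wpDl.
have hsum (X : nat -> R) n : (forall i, 0 <= X i) ->
    \sum_(i < n) (X i * `|y i| - u i * phi (X i)) <= M - s.
  move=> X0; pose x : {poly R} := \poly_(i < n) X i.
  have := hs x; rewrite (@pairingE _ _ _ n) ?size_poly//.
  have x0 i : 0 <= x`_i by rewrite coef_poly; case: ifP.
  move=> /(_ x0).
  have -> : \sum_(i < size x) u i * phi x`_i = \sum_(i < n) u i * phi x`_i.
    have xn : (size x <= n)%N by exact: size_poly.
    rewrite -[in RHS](subnKC xn) big_split_ord /= [X in _ + X]big1 ?addr0// => i _.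
    by rewrite [x`_ _]nth_default ?leq_addr// orlicz0// mulr0.
  have -> : \sum_(i < n) `|y i| * x`_i = \sum_(i < n) X i * `|y i|.
    by apply: eq_bigr => i _; rewrite coef_poly ltn_ord mulrC.
  have -> : \sum_(i < n) u i * phi x`_i = \sum_(i < n) u i * phi (X i).
    by apply: eq_bigr => i _; rewrite coef_poly ltn_ord.
  by rewrite sumrB; lra.
have hterm i X : 0 <= X -> X * `|y i| - u i * phi X <= M - s.
  move=> X0; have := hsum (fun j => if j == i then X else 0) i.+1.
  rewrite (bigD1 ord_max)//= eqxx big1 ?addr0; last first.
    by move=> j /negbTE ji; rewrite -[j == i :> nat]/(j == ord_max) ji mul0r orlicz0// mulr0 subr0.
  by apply=> j; case: ifP.
(* This excludes the infinite value of [p_term]: if [u i = 0], the multiples of the absolute value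
   of [y i] are all bounded by [M - s]. *)
have uy i : u i = 0 -> y i = 0.
  move=> ui; apply/eqP; rewrite -normr_eq0 eq_le normr_ge0 andbT leNgt; apply/negP => yi.
  have h X : 0 <= X -> X * `|y i| <= M - s.
    by move=> /(hterm i); rewrite ui mul0r subr0.
  have Ms : 0 <= M - s by have := h 0 (lexx 0); rewrite mul0r.
  have := h ((M - s + 1) / `|y i|); rewrite divfK ?gt_eqF// => /(_ _).
  have /[swap] /[apply] : 0 <= (M - s + 1) / `|y i| by rewrite divr_ge0 ?(ltW yi)//; lra.
  by lra.
exists (s + e)^-1; first by rewrite invr_gt0.
set k := (s + e)^-1; have k0 : 0 < k by rewrite invr_gt0.
have kse : k * (s + e) = 1 by rewrite mulVf ?gt_eqF.
have kuw : subweight w (fun i => k * u i).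
  split=> [i|l ul]; first by rewrite mulr_ge0 ?(ltW k0).
  rewrite -mulr_sumr; apply: le_trans (ler_wpM2l (ltW k0) (uw l ul)) _.
  rewrite -mulr_sumr mulrA ler_piMl ?sumr_ge0//.
  by rewrite -kse ler_pM2l// lerDl ltW.
apply: le_trans (_ : _ <= \sum_(0 <= i <oo) p_term psi (k * y i) (k * u i))%E _.
  apply: ereal_inf_lbound; exists (fun i => k * u i) => //; split; first by case: kuw.
  exact: subweight_submajorized.
apply: nneseries_le_bound => [i|n]; first by apply: p_term_ge0 => //; case: kuw.
have termE i : p_term psi (k * y i) (k * u i) = (k * (u i * psi (`|y i| / u i)))%:E.
  rewrite /p_term mulf_eq0 gt_eqF//=; case: eqP => [ui|/eqP ui].
    by rewrite uy// mulr0 eqxx ui !mul0r mulr0.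
  congr (_%:E); rewrite normrM (gtr0_norm k0) -mulf_div divff ?gt_eqF// mul1r.
  by rewrite mulrC mulrA.
under eq_bigr do rewrite termE.
rewrite sumEFin lee_fin -mulr_sumr.
rewrite (_ : k * (M + e) - 1 = k * (M - s)); last by rewrite -kse; ring.
rewrite ler_pM2l//; apply/ler_addgt0Pr => d d0.
(* Near-maximizers in the definition of [psi], with errors summing to at most [d] over the [n]
   terms; together they form one test sequence for [hsum]. *)
have /choice[X hX] : forall i, exists X, 0 <= X /\
    u i * psi (`|y i| / u i) <= X * `|y i| - u i * phi X + d / n.+1%:R.
  move=> i; have dn : 0 < d / n.+1%:R by rewrite divr_gt0.
  have := u0 i; rewrite le_eqVlt => /predU1P[ui|ui].
    by exists 0; split=> //; rewrite -ui !mul0r subr0 add0r ltW.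
  have [|X X0 hX] := complementary_adherent nphi (`|y i| / u i) (e := d / n.+1%:R / u i).
    by rewrite !divr_gt0.
  exists X; split=> //; apply: le_trans (ler_wpM2l (ltW ui) hX) _.
  rewrite le_eqVlt; apply/predU1P; left; field.
  by rewrite (gt_eqF ui) andbT addrC natr1 pnatr_eq0.
apply: le_trans (_ : _ <= \sum_(i < n) (X i * `|y i| - u i * phi (X i) + d / n.+1%:R)) _.
  by apply: ler_sum => i _; exact: (hX i).2.
rewrite big_split /= lerD//; first by apply: hsum => i; exact: (hX i).1.
rewrite sumr_const card_ord -[leLHS]mulr_natr -mulrA ler_piMr ?(ltW d0)//.
by rewrite ler_pdivrMl// mulr1 ler_nat.
Qed.

Lemma m0_norm_le_pairing : (m0_norm psi w y <= M%:E)%E.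
Proof.
apply/lee_addgt0Pr => e e0; have [k k0 pk] := p_modular_le_pairing e0.
apply: ge_ereal_inf; exists ((k^-1)%:E * (1 + p_modular psi w (fun i => k * y i)%R))%E.
  by exists k.
apply: le_trans (_ : _ <= (k^-1)%:E * (1 + (k * (M + e) - 1)%:E))%E _.
  by rewrite lee_pmul2l ?lte_fin ?invr_gt0// leeD2l.
by rewrite -EFinD -EFinM addrC subrK mulKf ?gt_eqF// EFinD.
Qed.

Lemma m0_space_of_pairing : m0_space psi w y.
Proof.
have [k k0 pk] := p_modular_le_pairing ltr01.
by exists k => //; apply: le_lt_trans pk _; exact: ltry.
Qed.

End UpperBound.
End Amemiya.

(** * The Luxemburg norm *)

Section Luxemburg.
Context {R : realType} (phi : R -> R) (w : nat -> R).
Hypotheses (ophi : orlicz_function phi) (ww : weight w).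
Implicit Types x y z : nat -> R.

Let w0 : forall j, 0 <= w j := weight_ge0 ww.

Definition truncation n x i : R := if (i < n)%N then x i else 0.
Definition tail n x i : R := if (i < n)%N then 0 else x i.

Lemma truncation_abs_le n x i : `|truncation n x i| <= `|x i|.
Proof. by rewrite /truncation; case: ifP => // _; rewrite normr0. Qed.

Lemma tail_abs_le n x i : `|tail n x i| <= `|x i|.
Proof. by rewrite /tail; case: ifP => // _; rewrite normr0. Qed.

Lemma truncationD_tail n x : x = (fun i => truncation n x i + tail n x i).
Proof.
by apply/funext => i; rewrite /truncation /tail; case: ifP; rewrite ?addr0 ?add0r.
Qed.

Lemma le_modular_bound x y B : (forall i, `|x i| <= `|y i|) ->
  modular_bound phi w y B -> modular_bound phi w x B.
Proof.
move=> xy yB s us; apply: le_trans (yB s us); apply: ler_wsum => // i _.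
by apply: orlicz_le => //; exact: xy.
Qed.

Lemma modular_boundZ x B t : 0 <= t <= 1 -> modular_bound phi w x B ->
  modular_bound phi w (fun i => t * x i) (t * B).
Proof.
move=> t01 xB s us; have /andP[t0 _] := t01.
apply: le_trans (ler_wpM2l t0 (xB s us)); rewrite -wsumZ.
by apply: ler_wsum => // i _; rewrite normrM ger0_norm// orlicz_scale.
Qed.

Lemma modular_boundD x y A B : (forall i, x i = 0 \/ y i = 0) ->
  modular_bound phi w x A -> modular_bound phi w y B ->
  modular_bound phi w (fun i => x i + y i) (A + B).
Proof.
move=> xy xA yB s us; apply: le_trans (lerD (xA s us) (yB s us)).
rewrite -wsumD; apply: ler_wsum => // i _.
by case: (xy i) => ->; rewrite normr0 (orlicz0 ophi) !(addr0, add0r).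
Qed.

(** Otherwise arbitrarily long lists have all values above [e], and since the weights have infinite
    sum their weighted sums exceed [B]. *)
Lemma modular_bound_vanish x B e : modular_bound phi w x B -> 0 < e ->
  exists N, forall i, (N <= i)%N -> phi `|x i| <= e.
Proof.
move=> xB e0; apply: contrapT => h.
have {}h N : exists2 i, (N <= i)%N & e < phi `|x i|.
  apply: contrapT => hN; apply: h; exists N => i Ni.
  by rewrite leNgt; apply/negP => ei; apply: hN; exists i.
have [n Bn] := weight_unbounded (B / e) ww.
have [s [us sn hs]] : exists s, [/\ uniq s, size s = n &
    {in s, forall i, e < phi `|x i|}].
  elim: n {Bn} => [|n [s [us sn hs]]]; first by exists [::].
  have [m sm] := seq_nat_ubound s; have [i mi ei] := h m.
  exists (i :: s); split; rewrite /= ?sn ?us ?andbT//.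
    by apply/negP => /sm; rewrite ltnNge mi.
  by move=> k; rewrite inE => /predU1P[->//|/hs].
have := le_trans (ler_wsum w0 (a := fun=> e) (fun i si => ltW (hs i si))) (xB s us).
by rewrite /wsum -mulr_sumr sn leNgt mulrC -ltr_pdivrMr// Bn.
Qed.

(** Let [s], of length [m], be optimal up to [e / 2] among all lists. In a list far out, the first
    [m] entries contribute at most [e / 2] because the values vanish at infinity; the later ones
    keep their weights when appended to [s], so they gain at most [e / 2]. *)
Lemma modular_bound_tail x B e : modular_bound phi w x B -> 0 < e ->
  exists N, forall n, (N <= n)%N -> modular_bound phi w (tail n x) e.
Proof.
move=> xB e0; pose a i := phi `|x i|.
have a0 i : 0 <= a i by exact: orlicz_ge0.
pose S := [set wsum w a s | s in [set s : seq nat | uniq s]].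
have ubS : has_ubound S by exists B => _ [s us <-]; exact: xB.
have [||_ [s us <-] hs] := @sup_adherent _ S (e / 2); first by rewrite divr_gt0.
  by split=> //; exists (wsum w a [::]), [::].
set m := size s; pose eta := e / 2 / (m%:R * w 0%N + 1).
have mw : 0 < m%:R * w 0%N + 1 by rewrite ltr_wpDl// mulr_ge0.
have eta0 : 0 < eta by rewrite !divr_gt0.
have [N1 hN1] := modular_bound_vanish xB eta0; have [N2 hN2] := seq_nat_ubound s.
exists (maxn N1 N2) => n; rewrite geq_max => /andP[N1n N2n] t ut.
have tail_lt i : (i < n)%N -> phi `|tail n x i| = 0.
  by rewrite /tail => ->; rewrite normr0 orlicz0.
have := @wsum_filter _ w (fun i => phi `|tail n x i|) (fun i => (n <= i)%N) t w0
  (weightS ww) (fun=> orlicz_ge0 ophi (normr_ge0 _)).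
move=> /(_ ltac:(by move=> i; rewrite -ltnNge => /tail_lt)) /le_trans; apply.
set t' := seq.filter _ t; have ut' : uniq t' by rewrite filter_uniq.
have t'n i : i \in t' -> (n <= i)%N by rewrite mem_filter => /andP[].
apply: (@le_trans _ _ (wsum w a t')).
  by apply: ler_wsum => // i /t'n ni; rewrite /tail ltnNge ni.
rewrite -(cat_take_drop m t') wsum_cat (splitr e); apply: lerD.
  apply: (@le_trans _ _ (wsum w (fun=> eta) (take m t'))).
    apply: ler_wsum => // i /mem_take /t'n ni; apply: hN1; exact: leq_trans ni.
  have e2 : 0 < e / 2 by rewrite divr_gt0.
  rewrite /wsum -mulr_sumr /eta mulrAC ler_pdivrMr// ler_pM2l//.
  apply: (@le_trans _ _ (m%:R * w 0%N)); last by rewrite lerDl.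
  apply: (@le_trans _ _ (\sum_(j < size (take m t')) w 0%N)).
    by apply: ler_sum => j _; have /nonincreasing_seqP := weightS ww; apply.
  by rewrite sumr_const card_ord -[leLHS]mulr_natl ler_wpM2r// ler_nat size_take_min geq_minl.
have [tm|mt] := leqP (size t') m.
  by rewrite drop_oversize// /wsum big_ord0 divr_ge0// ltW.
rewrite size_takel ?(ltnW mt)//.
(* Every entry of [t'] is at least [n], beyond all entries of [s]. *)
have ust : uniq (s ++ drop m t').
  rewrite cat_uniq us drop_uniq// andbT; apply/hasPn => i /mem_drop /t'n ni.
  by apply/negP => /hN2; rewrite ltnNge (leq_trans N2n ni).
have : wsum w a (s ++ drop m t') <= sup S by apply: ub_le_sup => //; exists (s ++ drop m t').
by rewrite wsum_cat -/m; move: hs; lra.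
Qed.

Lemma luxemburg_ge0 x : (0 <= luxemburg phi w x)%E.
Proof. by apply: le_ereal_inf_tmp => _ [e [e0 _] <-]; rewrite lee_fin ltW. Qed.

Lemma le_luxemburg x y : (forall i, `|x i| <= `|y i|) ->
  (luxemburg phi w x <= luxemburg phi w y)%E.
Proof.
move=> xy; apply: ereal_inf_le_tmp => _ [e [e0 ye] <-].
exists e; last by [].
split; first by [].
apply: le_trans ye.
apply: le_modular => // i.
by rewrite !normrM ler_wpM2r.
Qed.

Lemma luxemburg_le1 x : (modular phi w x <= 1)%E -> (luxemburg phi w x <= 1)%E.
Proof.
move=> x1; apply: ereal_inf_lbound; exists 1; last by [].
split; first exact: ltr01.
suff -> : (fun i => x i / 1) = x by [].
by apply/funext => i; rewrite divr1.
Qed.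

(** Some admissible [e] in the Luxemburg infimum lies below the inverse of [t], and [t * x] is
    dominated by [x / e]. *)
Lemma modular_scale_le1 x t : (luxemburg phi w x <= 1)%E -> 0 < t < 1 ->
  (modular phi w (fun i => t * x i)%R <= 1)%E.
Proof.
move=> x1 /andP[t0 t1].
have : (luxemburg phi w x < (t^-1)%:E)%E.
  by apply: le_lt_trans x1 _; rewrite lte_fin invf_gt1.
move=> /ereal_inf_ltP[_ [e [e0 xe] <-]]; rewrite lte_fin => et.
apply: le_trans xe; apply: le_modular => // i.
rewrite !normrM mulrC ler_wpM2l// gtr0_norm// gtr0_norm ?invr_gt0//.
by rewrite -[leLHS]invrK lef_pV2 ?posrE ?invr_gt0// ltW.
Qed.

Lemma orlicz_lorentz_modular x : (modular phi w x < +oo)%E -> orlicz_lorentz phi w x.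
Proof.
move=> xoo; exists 1; first exact: ltr01.
suff -> : (fun i => 1 * x i) = x by [].
by apply/funext => i; rewrite mul1r.
Qed.

Lemma le_orlicz_lorentz x y : (forall i, `|x i| <= `|y i|) ->
  orlicz_lorentz phi w y -> orlicz_lorentz phi w x.
Proof.
move=> xy [e e0 ye]; exists e; first exact: e0.
apply: le_lt_trans ye; apply: le_modular => // i.
by rewrite !normrM ler_wpM2l.
Qed.

Lemma orlicz_lorentzZ x a : orlicz_lorentz phi w x -> orlicz_lorentz phi w (fun i => a * x i).
Proof.
move=> [e e0 xe]; have a1 : 0 < `|a| + 1 by rewrite ltr_wpDl.
exists (e / (`|a| + 1)); first by rewrite divr_gt0.
apply: le_lt_trans xe; apply: le_modular => // i.
rewrite mulrA !normrM ler_wpM2r// normrV ?unitfE ?gt_eqF// (gtr0_norm a1).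
by rewrite mulrAC ler_pdivrMr// ler_wpM2l// lerDl.
Qed.

Lemma orlicz_lorentz_unit x : modular_bound phi w x 1 -> forall t : R, 0 < t < 1 ->
  orlicz_lorentz phi w (fun i => t * x i) /\ (luxemburg phi w (fun i => t * x i)%R <= 1)%E.
Proof.
move=> x1 t t01; have tx := modular_le_of_bound ophi ww t01 x1.
by split; [apply: orlicz_lorentz_modular; apply: le_lt_trans tx (ltry _)|exact: luxemburg_le1].
Qed.

Lemma luxemburg_fin_num x : orlicz_lorentz phi w x -> luxemburg phi w x \is a fin_num.
Proof.
move=> [e e0 xe]; rewrite ge0_fin_numE ?luxemburg_ge0//.
have mfin : modular phi w (fun i => e * x i) \is a fin_num.
  by rewrite ge0_fin_numE// modular_ge0.
set ex := fun i => e * x i in xe mfin; pose m := fine (modular phi w ex).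
have m0 : 0 <= m by rewrite fine_ge0// modular_ge0.
have exm : modular_bound phi w ex m.
  by apply: (modular_bound_of_modular ophi ww); rewrite fineK.
have m1 : 0 < m + 1 by rewrite ltr_wpDl.
(* Convexity lets division by [m + 1] bring the list bound below 1; the further factor one half
   returns from the list bound to the modular. *)
have t01 : 0 <= (m + 1)^-1 <= 1 by rewrite invr_ge0 ltW//= invf_le1// lerDr.
have tm : (m + 1)^-1 * m <= 1 by rewrite ler_pdivrMl// mulr1 lerDl.
have b1 : modular_bound phi w (fun i => (m + 1)^-1 * ex i) 1.
  by move=> s us; apply: le_trans tm; exact: (modular_boundZ t01 exm us).
have half : 0 < 2^-1 :> R by rewrite invr_gt0.
have h := modular_le_of_bound ophi ww (t := 2^-1) ltac:(by rewrite half/= invf_lt1// ltr1n) b1.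
apply: le_lt_trans (ltry (2^-1 * (m + 1)^-1 * e)^-1).
apply: ereal_inf_lbound; exists (2^-1 * (m + 1)^-1 * e)^-1; last by [].
split; first by rewrite invr_gt0 !mulr_gt0 ?invr_gt0.
rewrite (_ : (fun i => _) = (fun i => 2^-1 * ((m + 1)^-1 * ex i)))//.
by apply/funext => i; rewrite invrK mulrC /ex !mulrA.
Qed.

Lemma orlicz_lorentz_truncation n x : orlicz_lorentz phi w (truncation n x).
Proof.
pose a i := phi `|truncation n x i|.
have b : modular_bound phi w (truncation n x) (w 0%N * \sum_(i < n) `|a i|).
  move=> s us; have := wsum_lbound w0 (weightS ww) (a := a) (n := n) _ us.
  move=> /(_ _)/andP[|_ //] i ni; by rewrite /a /truncation ltnNge ni normr0 orlicz0.
have half : 0 < 2^-1 :> R by rewrite invr_gt0.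
exists 2^-1; first exact: half.
apply: le_lt_trans (ltry (w 0%N * \sum_(i < n) `|a i|)).
by apply: modular_le_of_bound => //; rewrite half/= invf_lt1// ltr1n.
Qed.

End Luxemburg.

(** * Bounded functionals *)

(** Used to remove the factors [t < 1] that arise in passing between the Luxemburg norm, the modular
    and its list bound. *)
Lemma ler_of_scaled (R : realType) (c d : R) :
  (forall t, 0 < t < 1 -> t * c <= d) -> c <= d.
Proof.
move=> h; have [c0|c0] := leP c 0.
  by have := h (1 / 2) ltac:(by apply/andP; split; lra); lra.
have [d0|d0] := ltP d 0.
  by have := h (1 / 2) ltac:(by apply/andP; split; lra); lra.
rewrite leNgt; apply/negP => dc.
have q1 : d / c < 1 by rewrite ltr_pdivrMr// mul1r.
have q0 : 0 <= d / c by rewrite divr_ge0// ltW.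
have := h ((d / c + 1) / 2) ltac:(by apply/andP; split; lra).
by rewrite mulrAC mulrDl mul1r divfK ?gt_eqF//; lra.
Qed.

Section Functionals.
Context {R : realType} (phi : R -> R) (w : nat -> R).
Hypotheses (nphi : N_function phi) (ww : weight w).
Implicit Types (x y z : nat -> R) (F : (nat -> R) -> R).

Let ophi : orlicz_function phi. Proof. by case: nphi. Qed.
Let w0 : forall j, 0 <= w j := weight_ge0 ww.
Let Lam := orlicz_lorentz phi w.
Let lux := luxemburg phi w.

Lemma bounded_functional_fine F : bounded_functional phi w F ->
  exists2 K, 0 <= K & forall x, Lam x -> `|F x| <= K * fine (lux x).
Proof.
move=> [_ [C hC]]; exists `|C| => // x xL; have lf := luxemburg_fin_num ophi ww xL.
have := hC x xL; rewrite -(fineK lf) -EFinM lee_fin => /le_trans; apply.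
by rewrite ler_wpM2r ?ler_norm// fine_ge0// luxemburg_ge0.
Qed.

Lemma orlicz_lorentz0 : Lam (fun=> 0).
Proof.
have := orlicz_lorentz_truncation ophi ww 0 (fun=> 0).
by rewrite (_ : truncation _ _ = (fun=> 0))//; apply/funext => i; rewrite /truncation.
Qed.

Section LinearTheory.
Variable F : (nat -> R) -> R.
Hypothesis Fbd : bounded_functional phi w F.

Lemma functional0 : F (fun=> 0) = 0.
Proof.
have := Fbd.1 1 _ _ orlicz_lorentz0 orlicz_lorentz0.
by rewrite (_ : (fun i => _) = (fun=> 0)); [lra|apply/funext => i; rewrite mulr0 addr0].
Qed.

Lemma functionalD x z : Lam x -> Lam z -> F (fun i => x i + z i) = F x + F z.
Proof.
move=> xL zL; have := Fbd.1 1 x z xL zL; rewrite mul1r => <-.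
by congr F; apply/funext => i; rewrite mul1r.
Qed.

Lemma functionalZ a x : Lam x -> F (fun i => a * x i) = a * F x.
Proof.
move=> xL; have := Fbd.1 a _ _ xL orlicz_lorentz0; rewrite functional0 addr0 => <-.
by congr F; apply/funext => i; rewrite addr0.
Qed.

Let y i := F (fun j => (j == i)%:R).

Lemma functional_truncation x n : F (truncation n x) = \sum_(i < n) x i * y i.
Proof.
elim: n => [|n ih].
  rewrite big_ord0 (_ : truncation 0 x = fun=> 0) ?functional0//.
rewrite big_ord_recr /= -ih addrC.
have dL : Lam (fun j => (j == n)%:R).
  apply: (le_orlicz_lorentz ophi ww) (orlicz_lorentz_truncation ophi ww n.+1 (fun=> 1)) => i.
  rewrite /truncation; have [->|_] := eqVneq i n; first by rewrite ltnSn.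
  by rewrite normr0.
rewrite -(Fbd.1 _ _ _ dL (orlicz_lorentz_truncation ophi ww n x)).
congr F; apply/funext => i; rewrite /truncation ltnS leq_eqVlt.
have [->|_] := eqVneq i n; first by rewrite ltnn mulr1 addr0.
by rewrite mulr0 add0r.
Qed.

(** [F] is tested on a truncation of [x] with signs adapted to [y]. This bound gives absolute
    convergence of the series that defines the regular part. *)
Lemma functional_abs_sum_le K : (forall x, Lam x -> `|F x| <= K * fine (lux x)) ->
  0 <= K -> forall x n, Lam x -> \sum_(i < n) `|x i| * `|y i| <= K * fine (lux x).
Proof.
move=> FK K0 x n xL; pose x' i := Num.sg (y i) * `|x i|.
have xx' i : `|truncation n x' i| <= `|x i|.
  apply: (le_trans (truncation_abs_le _ _ _)).
  by rewrite normrM normr_id normr_sg ler_piMl// lern1 leq_b1.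
have tL := orlicz_lorentz_truncation ophi ww n x'.
rewrite (_ : \sum_(i < n) _ = F (truncation n x')); last first.
  rewrite functional_truncation; apply: eq_bigr => i _.
  by rewrite mulrAC -normrEsg mulrC.
apply: le_trans (ler_norm _) _; apply: le_trans (FK _ tL) _.
apply: (ler_wpM2l K0); apply: fine_le.
- exact: (luxemburg_fin_num ophi ww tL).
- exact: (luxemburg_fin_num ophi ww xL).
- exact: (le_luxemburg ophi ww xx').
Qed.

End LinearTheory.

Lemma dual_norm_ge0 F : (0 <= dual_norm phi w F)%E.
Proof.
apply: le_trans (_ : _ <= `|F (fun=> 0)%R|%:E)%E _; first by rewrite lee_fin.
apply: ereal_sup_ubound; exists (fun=> 0); last by [].
split; first exact: orlicz_lorentz0.
apply: luxemburg_le1 => //; apply: nneseries_le_bound => [i|n].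
  exact: modular_term_ge0.
rewrite big1 ?lee01// => i _; rewrite (_ : rearrangement _ _ = 0%E) ?orlicz0 ?mul0e//=.
  by rewrite orlicz0// mul0e.
apply/eqP; rewrite eq_le rearrangement_ge0 andbT; apply/lee_addgt0Pr => e e0.
rewrite add0e; apply: ereal_inf_lbound; exists e; last by [].
split; first exact: e0.
apply: le_lt_trans (counting_le_size (s := [::]) _) _; last by rewrite lte_fin ltr_nat.
by move=> j /=; rewrite normr0 ltNge ltW.
Qed.

Lemma dual_norm_fin_num F : bounded_functional phi w F -> dual_norm phi w F \is a fin_num.
Proof.
move=> /bounded_functional_fine[K K0 FK]; rewrite ge0_fin_numE ?dual_norm_ge0//.
apply: le_lt_trans (ltry K); apply: ge_ereal_sup => _ [x [xL x1] <-].
rewrite lee_fin; apply: le_trans (FK _ xL) _; rewrite ler_piMr//.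
by rewrite -lee_fin (fineK (luxemburg_fin_num ophi ww xL)).
Qed.

Lemma dual_norm_ub F x : bounded_functional phi w F -> Lam x -> (lux x <= 1)%E ->
  `|F x| <= fine (dual_norm phi w F).
Proof.
move=> Fb xL x1; rewrite -lee_fin fineK ?dual_norm_fin_num//.
by apply: ereal_sup_ubound; exists x; last by [].
Qed.

(** * Functionals given by a pairing, and their norm *)

Section Pairing.
Context (y : nat -> R) (K : R).
Hypothesis yK : forall x n, Lam x -> \sum_(i < n) `|x i| * `|y i| <= K * fine (lux x).

Definition pairing_functional x : R := limn (series (fun i => x i * y i)).
Local Notation H := pairing_functional.

Lemma pairing_functional_cvg x : Lam x ->
  series (fun i => x i * y i) n @[n --> \oo] --> H x.
Proof.
move=> xL; apply: (@normed_cvg R R^o); apply: nondecreasing_is_cvgn.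
  apply/nondecreasing_seqP => n.
  by rewrite /normed_series_of seriesSr lerDl normr_ge0.
exists (K * fine (lux x)) => _ [n _ <-] /=.
rewrite /series /= big_mkord; apply: le_trans (yK n xL).
by apply: ler_sum => i _; rewrite normrM.
Qed.

Lemma pairing_functional_le x B : Lam x ->
  (forall n, \sum_(i < n) `|x i| * `|y i| <= B) -> `|H x| <= B.
Proof.
move=> xL xB; have cH := pairing_functional_cvg xL.
apply: (cvgr_to_le (cvg_norm cH)); apply: nearW => n.
rewrite /series /= big_mkord; apply: le_trans (xB n).
apply: le_trans (ler_norm_sum _ _ _) _.
by apply: ler_sum => i _; rewrite normrM.
Qed.

Lemma pairing_functional_bounded : bounded_functional phi w H.
Proof.
split=> [a x z xL zL|].
  rewrite /H; apply: cvg_lim => //.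
  rewrite (_ : series _ = (fun n => a * series (fun i => x i * y i) n +
      series (fun i => z i * y i) n)); last first.
    apply/funext => n; rewrite /series /= mulr_sumr -big_split /=.
    by apply: eq_bigr => i _; rewrite mulrDl mulrA.
  have cx := pairing_functional_cvg xL; have cz := pairing_functional_cvg zL.
  exact: (cvgD (cvgM (cvg_cst a) cx) cz).
exists K => x xL; rewrite -(fineK (luxemburg_fin_num ophi ww xL)) -EFinM lee_fin.
by apply: pairing_functional_le => // n; exact: yK.
Qed.

Lemma pairing_functional_truncation n x : H (truncation n x) = \sum_(i < n) x i * y i.
Proof.
apply: lim_near_cst => //; exists n => // m /= nm.
rewrite /series /= big_mkord -[in LHS](subnKC nm) big_split_ord /= [X in _ + X]big1 ?addr0.
  by apply: eq_bigr => i _; rewrite /truncation ltn_ord.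
by move=> i _; rewrite /truncation ltnNge leq_addr mul0r.
Qed.

Lemma dual_norm_pairing_le :
  (dual_norm phi w H <= m0_norm (complementary phi) w y)%E.
Proof.
apply: ge_ereal_sup => _ [x [xL x1] <-].
apply: le_ereal_inf_tmp => _ [k k0 <-]; rewrite /= in k0.
set rhs := (X in (_ <= X)%E).
have bound t n : 0 < t < 1 -> ((\sum_(i < n) `|t * x i| * `|y i|)%:E <= rhs)%E.
  move=> t01; rewrite /rhs.
  exact: (pairing_le_p_modular nphi ww y n k0 (modular_scale_le1 ophi ww x1 t01)).
have : (0 <= rhs)%E.
  have := bound (1 / 2) 0%N ltac:(by apply/andP; split; lra).
  by rewrite big_ord0.
(* The bound may be infinite; in the finite case the scaling [t] is removed at the end. *)
clearbody rhs; move: rhs bound => [r||] //.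
  move=> bound _; rewrite lee_fin; apply: ler_of_scaled => t t01.
  have t0 : 0 < t by case/andP: t01.
  rewrite -ler_pdivlMl//; apply: pairing_functional_le => // n.
  rewrite ler_pdivlMl// mulr_sumr; have := bound t n t01; rewrite lee_fin.
  by under eq_bigr do rewrite normrM (gtr0_norm t0) -mulrA.
by move=> _ _; rewrite leey.
Qed.

(** The hypothesis of the multiplier argument with [M] the dual norm of [H]: the signs of [y] are
    transferred to [x], which does not change the list bound. *)
Lemma pairing_abs_le (x : {poly R}) : (forall i, 0 <= x`_i) ->
  modular_bound phi w (nth 0 x) 1 ->
  pairing (fun i => `|y i|) x <= fine (dual_norm phi w H).
Proof.
move=> x0 x1; pose x' := truncation (size x) (fun i => Num.sg (y i) * x`_i).
have x'1 : modular_bound phi w x' 1.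
  apply: (le_modular_bound ophi ww) x1 => i.
  apply: le_trans (truncation_abs_le _ _ _) _.
  by rewrite normrM normr_sg ler_piMl// lern1 leq_b1.
apply: ler_of_scaled => t t01; have [tL t1] := orlicz_lorentz_unit ophi ww x'1 t01.
have Hb := pairing_functional_bounded.
apply: le_trans (dual_norm_ub Hb tL t1); apply: le_trans (ler_norm _).
rewrite (functionalZ Hb); last exact: orlicz_lorentz_truncation.
rewrite pairing_functional_truncation le_eqVlt; apply/predU1P; left; congr (_ * _).
by apply: eq_bigr => i _; rewrite mulrAC -normrEsg.
Qed.

Lemma pairing_m0_space : m0_space (complementary phi) w y.
Proof. exact: (m0_space_of_pairing nphi ww pairing_abs_le). Qed.

Lemma dual_norm_pairing : dual_norm phi w H = m0_norm (complementary phi) w y.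
Proof.
apply/eqP; rewrite eq_le dual_norm_pairing_le /=.
rewrite -(fineK (dual_norm_fin_num pairing_functional_bounded)).
exact: (m0_norm_le_pairing nphi ww pairing_abs_le).
Qed.

End Pairing.
End Functionals.

(** * The singular part and additivity of the norm *)

Section Decomposition.
Context {R : realType} (phi : R -> R) (w : nat -> R) (F : (nat -> R) -> R).
Hypotheses (nphi : N_function phi) (ww : weight w).
Hypothesis Fb : bounded_functional phi w F.
Implicit Types x z : nat -> R.

Let ophi : orlicz_function phi. Proof. by case: nphi. Qed.

Local Notation Lam := (orlicz_lorentz phi w).
Local Notation lux := (luxemburg phi w).

Definition coefficients i : R := F (fun j => (j == i)%:R).
Local Notation y := coefficients.
Local Notation H := (pairing_functional y).

Definition singular_part x : R := F x - H x.
Local Notation S := singular_part.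

Let yK : exists2 K, 0 <= K &
  forall x n, Lam x -> \sum_(i < n) `|x i| * `|y i| <= K * fine (lux x).
Proof.
have [K K0 FK] := bounded_functional_fine nphi ww Fb.
by exists K => // x n xL; exact: (functional_abs_sum_le nphi ww Fb FK K0 n xL).
Qed.

Let Hb : bounded_functional phi w H.
Proof. by have [K _ h] := yK; exact: (pairing_functional_bounded nphi ww h). Qed.

Let Hcvg x : Lam x -> series (fun i => x i * y i) n @[n --> \oo] --> H x.
Proof. by have [K _ h] := yK; exact: (pairing_functional_cvg h). Qed.

Lemma singular_part_bounded : bounded_functional phi w S.
Proof.
split=> [a x z xL zL|].
  by rewrite /singular_part (Fb.1 a x z xL zL) (Hb.1 a x z xL zL); ring.
have [K K0 FK] := bounded_functional_fine nphi ww Fb.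
have [L L0 HL] := bounded_functional_fine nphi ww Hb.
exists (K + L) => x xL.
rewrite -(fineK (luxemburg_fin_num ophi ww xL)) -EFinM lee_fin mulrDl.
apply: le_trans (ler_normB _ _) _; exact: lerD (FK x xL) (HL x xL).
Qed.

Lemma singular_part_truncation n x : S (truncation n x) = 0.
Proof.
by rewrite /singular_part (functional_truncation nphi ww Fb)
  pairing_functional_truncation subrr.
Qed.

Let tail_Lam n x : Lam x -> Lam (tail n x).
Proof. exact: (le_orlicz_lorentz ophi ww (tail_abs_le n x)). Qed.

Lemma functional_tail G n x : bounded_functional phi w G -> Lam x ->
  G (tail n x) = G x - G (truncation n x).
Proof.
move=> Gb xL; rewrite {2}(truncationD_tail n x).
rewrite (functionalD Gb (orlicz_lorentz_truncation ophi ww n x) (tail_Lam n xL)).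
by rewrite addrC addKr.
Qed.

Lemma singular_part_tail n x : Lam x -> S (tail n x) = S x.
Proof.
move=> xL.
by rewrite (functional_tail n singular_part_bounded xL) singular_part_truncation subr0.
Qed.

(** [S] takes the same value at [x] and at all its tails, whose norms tend to 0 by order continuity
    applied to the tails of the absolute value of [x]. *)
Lemma singular_part_singular : singular_functional phi w S.
Proof.
split=> [|x [xL xoc]]; first exact: singular_part_bounded.
have [K K0 SK] := bounded_functional_fine nphi ww singular_part_bounded.
pose u n i := tail n (fun i => `|x i|) i.
have [|||_ cu] := xoc u.
- move=> n i; rewrite /u /tail; case: ifP => _; first by rewrite lexx normr_ge0.
  by rewrite normr_ge0 lexx.
- move=> i; apply/nonincreasing_seqP => n; rewrite /u /tail ltnS.
  have [ni|ni] := leqP i n; first by case: ifP.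
  by rewrite ltnNge (ltnW ni).
- move=> i; apply: cvg_near_cst; exists i.+1 => // n /= ni.
  by rewrite /u /tail ni.
have cKu := cvgeZl (y := K%:E) isT cu.
have : (`|S x|%:E <= K%:E * 0)%E.
  apply: (cvge_to_ge cKu); apply: nearW => n.
  have tL := tail_Lam n xL.
  rewrite -(singular_part_tail n xL); apply: (@le_trans _ _ (K * fine (lux (tail n x)))%:E).
    by rewrite lee_fin; exact: SK.
  rewrite EFinM (fineK (luxemburg_fin_num ophi ww tL)).
  apply: lee_wpmul2l; first by rewrite lee_fin.
  apply: (le_luxemburg ophi ww) => i; rewrite /u /tail.
  by case: ifP => // _; rewrite normr_id.
by rewrite mule0 lee_fin normr_le0 => /eqP.
Qed.

Let functional_eq x : F x = H x + S x.
Proof. by rewrite /singular_part addrC subrK. Qed.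

(* [x] is cut to a finite block and [z] is cut far outside of it: this leaves
   [S z] unchanged while the modular of [z] becomes negligible. *)
Lemma pairing_add_singular_le x z : Lam x -> Lam z ->
  (lux x <= 1)%E -> (lux z <= 1)%E -> H x + S z <= fine (dual_norm phi w F).
Proof.
move=> xL zL x1 z1; set D := fine _.
(* The factor [t], on [x] only, leaves room [1 - t] in the modular for the tail of [z]; [r] turns
   Luxemburg norm at most 1 into modular at most 1; [q], introduced later, turns the list bound for
   the sum back into a norm bound. *)
rewrite -lerBrDr; apply: ler_of_scaled => t t01; rewrite lerBrDr.
apply: ler_of_scaled => r r01; have /andP[r0 r1] := r01; have /andP[t0 t1] := t01.
pose x2 i := t * (r * x i); pose z2 i := r * z i.
have rxL : Lam (fun i => r * x i) := orlicz_lorentzZ ophi ww r xL.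
have x2L : Lam x2 := orlicz_lorentzZ ophi ww t rxL.
have z2L : Lam z2 := orlicz_lorentzZ ophi ww r zL.
have -> : r * (t * H x + S z) = H x2 + S z2.
  rewrite /x2 (functionalZ nphi ww Hb t rxL) (functionalZ nphi ww Hb r xL).
  by rewrite (functionalZ nphi ww singular_part_bounded r zL); ring.
have x2b : modular_bound phi w x2 t.
  rewrite -[t]mulr1; apply: (modular_boundZ ophi ww).
    by rewrite !ltW.
  exact: (modular_bound_of_modular ophi ww (modular_scale_le1 ophi ww x1 r01)).
have z2b : modular_bound phi w z2 1.
  exact: (modular_bound_of_modular ophi ww (modular_scale_le1 ophi ww z1 r01)).
have t1' : 0 < 1 - t by rewrite subr_gt0.
have [N zN] := modular_bound_tail ophi ww z2b t1'.
apply: ler_of_scaled => q q01.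
(* The left side is [q] times [F] at the truncation of [x2] plus the tail of [z2]; as [n] grows, the
   contribution of [H] at the tail disappears. *)
have hn n : (N <= n)%N ->
    q * (\sum_(i < n) x2 i * y i + (H z2 - \sum_(i < n) z2 i * y i + S z2)) <= D.
  move=> Nn; pose g i := truncation n x2 i + tail n z2 i.
  have trL := orlicz_lorentz_truncation ophi ww n x2.
  have taL := tail_Lam n z2L.
  have g1 : modular_bound phi w g 1.
    rewrite -[1](subrK t) addrC; apply: (modular_boundD ophi ww).
    - by move=> i; rewrite /truncation /tail; case: ifP => _; [right|left].
    - exact: (le_modular_bound ophi ww (truncation_abs_le n x2) x2b).
    - exact: zN.
  have [gL glux] := orlicz_lorentz_unit ophi ww g1 q01.
  apply: le_trans (dual_norm_ub nphi ww Fb gL glux); apply: le_trans (ler_norm _).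
  have gL' : Lam g.
    have q0 : q != 0 by rewrite gt_eqF//; case/andP: q01.
    have := orlicz_lorentzZ ophi ww q^-1 gL.
    suff -> : (fun i => q^-1 * (q * g i)) = g by [].
    by apply/funext => i; rewrite mulKf.
  rewrite (functionalZ nphi ww Fb q gL') (functionalD Fb trL taL).
  rewrite (functional_truncation nphi ww Fb) functional_eq.
  rewrite (functional_tail n Hb z2L) pairing_functional_truncation.
  by rewrite (singular_part_tail n z2L).
have cx := Hcvg x2L; have cz := Hcvg z2L.
have c : q * (series (fun i => x2 i * y i) n +
    (H z2 - series (fun i => z2 i * y i) n + S z2)) @[n --> \oo] -->
    q * (H x2 + (H z2 - H z2 + S z2)).
  exact: (cvgM (cvg_cst q) (cvgD cx (cvgD (cvgB (cvg_cst (H z2)) cz) (cvg_cst (S z2))))).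
rewrite subrr add0r in c; apply: (cvgr_to_le c); exists N => // n /= Nn.
by rewrite /series /= !big_mkord; exact: hn.
Qed.

Let sign_scale (G : (nat -> R) -> R) x : bounded_functional phi w G ->
    Lam x -> (lux x <= 1)%E ->
  exists x', [/\ Lam x', (lux x' <= 1)%E & G x' = `|G x|].
Proof.
move=> Gb xL x1; exists (fun i => Num.sg (G x) * x i); split.
- exact: orlicz_lorentzZ.
- apply: le_trans x1; apply: (le_luxemburg ophi ww) => i.
  by rewrite normrM normr_sg ler_piMl// lern1 leq_b1.
- by rewrite (functionalZ nphi ww Gb _ xL) -normrEsg.
Qed.

Lemma dual_norm_decomposition :
  dual_norm phi w F = (dual_norm phi w H + dual_norm phi w S)%E.
Proof.
have Sb := singular_part_bounded.
have Ff := dual_norm_fin_num nphi ww Fb; have Hf := dual_norm_fin_num nphi ww Hb.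
have Sf := dual_norm_fin_num nphi ww Sb.
apply/eqP; rewrite eq_le; apply/andP; split.
  apply: ge_ereal_sup => _ [x [xL x1] <-].
  rewrite -(fineK Hf) -(fineK Sf) -EFinD lee_fin functional_eq.
  apply: le_trans (ler_normD _ _) _.
  exact: lerD (dual_norm_ub nphi ww Hb xL x1) (dual_norm_ub nphi ww Sb xL x1).
(* The two suprema are treated independently; sign changes of [x] and [z] then remove the absolute
   values. *)
rewrite -leeBrDr//; apply: ge_ereal_sup => _ [x [xL x1] <-].
rewrite leeBrDr// addrC -leeBrDr//; apply: ge_ereal_sup => _ [z [zL z1] <-].
rewrite -(fineK Ff) -EFinB lee_fin lerBrDr addrC.
have [x' [x'L x'1 <-]] := sign_scale Hb xL x1.
have [z' [z'L z'1 <-]] := sign_scale Sb zL z1.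
exact: pairing_add_singular_le.
Qed.

End Decomposition.

Theorem theorem3p3 (R : realType) (phi : R -> R) (w : nat -> R)
    (F : (nat -> R) -> R) :
  N_function phi -> weight w -> bounded_functional phi w F ->
  exists (y : nat -> R) (H S : (nat -> R) -> R),
    (forall x, orlicz_lorentz phi w x -> F x = H x + S x) /\
    m0_space (complementary phi) w y /\
    bounded_functional phi w H /\
    (forall x, orlicz_lorentz phi w x ->
       series (fun i => x i * y i) n @[n --> \oo] --> H x) /\
    dual_norm phi w H = m0_norm (complementary phi) w y /\
    singular_functional phi w S /\
    dual_norm phi w F
      = (m0_norm (complementary phi) w y + dual_norm phi w S)%E.
Proof.
move=> nphi ww Fb; have [K K0 FK] := bounded_functional_fine nphi ww Fb.
have yK x n (xL : orlicz_lorentz phi w x) :=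
  functional_abs_sum_le nphi ww Fb FK K0 n xL.
exists (coefficients F), (pairing_functional (coefficients F)), (singular_part F).
split; first by move=> x _; rewrite /singular_part addrC subrK.
split; first exact: (pairing_m0_space nphi ww yK).
split; first exact: (pairing_functional_bounded nphi ww yK).
split; first by move=> x xL; exact: (pairing_functional_cvg yK xL).
split; first exact: (dual_norm_pairing nphi ww yK).
split; first exact: (singular_part_singular nphi ww Fb).
rewrite -(dual_norm_pairing nphi ww yK); exact: (dual_norm_decomposition nphi ww Fb).
Qed.
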